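(* For any integers $N,l$, finite simple graphs $H_1,\dots,H_l$, real numbers $\beta_1,\dots,\beta_l$ and $\varepsilon\in(0,1/2)$, there exists a coupling $(G,G')$ such that $G$ has the law of the exponential random graph $$\mathbb{P}(G=g)=Z^{-1}\exp\Big(N^2\sum_{i=1}^l\beta_i t(H_i,g)\Big)\quad\text{for all simple graphs } g \text{ on } N \text{ vertices},$$ ($Z$ a normalizing constant), $G'$ is an $\varepsilon$-mixture, and $$\mathbb{E}\,d_H(G,G')\le\frac{20\binom N2^{11/12}}{\varepsilon^{1/3}}\left(\sum_{i=1}^l|\beta_i||E(H_i)|\right)^{1/3},$$ where $|E(H_i)|$ is the number of edges of $H_i$.
   Context: For finite graphs $H,G$ with $m,N$ vertices, $\mathrm{Hom}(H,G)$ is the number of maps from $V(H)$ to $V(G)$ sending every edge of $H$ to an edge of $G$, and $t(H,G)=\mathrm{Hom}(H,G)/N^m$. For $\vec p\in[0,1]^{\binom N2}$, $G(N,\vec p)$ is the random graph on $[N]$ with independent edges, edge $\{i,j\}$ present with probability $p_{i,j}$; $I(\vec p)=-\sum_{\{i,j\}}\big(p_{i,j}\log p_{i,j}+(1-p_{i,j})\log(1-p_{i,j})\big)=\mathrm{Ent}(G(N,\vec p))$. For a probability measure $\rho$ on $[0,1]^{\binom N2}$, $G(N,\rho)$ is the mixture with $\mathbb{P}(G(N,\rho)=g)=\int\mathbb{P}(G(N,\vec p)=g)\,d\rho(\vec p)$. A random graph $G$ on $N$ vertices is an $\varepsilon$-mixture if there is $\rho$ with $G\overset{d}{=}G(N,\rho)$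 and $\mathrm{Ent}(G)\le\int I(\vec p)\,d\rho(\vec p)+\varepsilon\binom N2$, where $\mathrm{Ent}$ is Shannon entropy. For graphs $g=(V,E),g'=(V,E')$, $d_H(g,g')=|E\triangle E'|$. *)

(* Defs.v *)
From HB Require Import structures.
From mathcomp Require Import all_boot all_order all_algebra.
From mathcomp Require Import all_classical all_reals all_analysis.
Set Implicit Arguments. Unset Strict Implicit. Unset Printing Implicit Defensive.
Import Order.TTheory GRing.Theory Num.Theory.
Import numFieldNormedType.Exports.
Local Open Scope ring_scope.

(* Unordered pairs {i,j} of distinct vertices of [N] = 'I_N, encoded as i < j. *)
Definition edge (N : nat) := {p : 'I_N * 'I_N | (p.1 < p.2)%N}.
HB.instance Definition _ N := Finite.copy (edge N) {p : 'I_N * 'I_N | (p.1 < p.2)%N}.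

Definition graph (N : nat) := {set edge N}.

Definition adj (N : nat) (g : graph N) (u v : 'I_N) : bool :=
  [exists e in g, (((val e).1 == u) && ((val e).2 == v))
                  || (((val e).1 == v) && ((val e).2 == u))].

Definition hom (m N : nat) (H : graph m) (g : graph N) : nat :=
  #|[set f : {ffun 'I_m -> 'I_N} |
      [forall e in H, adj g (f (val e).1) (f (val e).2)]]|.

Definition hom_density (R : realType) (m N : nat) (H : graph m) (g : graph N) : R :=
  (hom H g)%:R / (N%:R ^+ m).

Definition indep_prob (R : realType) (N : nat) (p : edge N -> R) (g : graph N) : R :=
  \prod_(e : edge N) (if e \in g then p e else 1 - p e).

(* I(p) = Ent(G(N,p)), natural logarithm *)
Definition Ient (R : realType) (N : nat) (p : edge N -> R) : R :=
  - \sum_(e : edge N) (p e * ln (p e) + (1 - p e) * ln (1 - p e)).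

(* Shannon entropy (natural log, 0 log 0 = 0) of a law q on graphs *)
Definition graph_entropy (R : realType) (N : nat) (q : graph N -> R) : R :=
  - \sum_(g : graph N) q g * ln (q g).

(* q is the law of an eps-mixture: q = law of G(N,rho) for a probability
   measure rho on [0,1]^{binom N 2}, represented as the pushforward of a
   probability P on some measurable space T under a measurable map
   x |-> p x in [0,1]^{edges}; and Ent <= \int I d rho + eps * binom N 2. *)
Definition eps_mixture (R : realType) (N : nat) (eps : R) (q : graph N -> R) : Prop :=
  exists (d : measure_display) (T : measurableType d)
         (P : probability T R) (p : T -> edge N -> R),
    (forall x e, 0 <= p x e <= 1) /\
    (forall e, measurable_fun setT (fun x => p x e)) /\
    (forall g, (q g)%:E = (\int[P]_x (indep_prob (p x) g)%:E)%E) /\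
    ((graph_entropy q)%:E <= (\int[P]_x (Ient (p x))%:E)%E + (eps * 'C(N, 2)%:R)%:E)%E.

Definition ergm_weight (R : realType) (N l : nat) (m : 'I_l -> nat)
    (H : forall i : 'I_l, graph (m i)) (beta : 'I_l -> R) (g : graph N) : R :=
  expR ((N%:R ^+ 2) * \sum_(i < l) beta i * hom_density R (H i) g).

Definition dH (N : nat) (g g' : graph N) : nat := #|(g :\: g') :|: (g' :\: g)|.

(* Main.v *)
Require Import Defs.
From HB Require Import structures.
From mathcomp Require Import all_boot all_order all_algebra.
From mathcomp Require Import all_classical all_reals all_analysis.
From mathcomp Require Import ring lra zify.
Set Implicit Arguments. Unset Strict Implicit. Unset Printing Implicit Defensive.
Import Order.TTheory GRing.Theory Num.Theory.
Local Open Scope ring_scope.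

(* Let nu be the law of the exponential random graph, n = 'C(N, 2), and let
   B = sum_i |beta_i| |E(H_i)|.  The log-odds h_e of an edge e given all the others
   is, up to an error of total size O(N B), a sum of weight B of terms
   1_A(x) 1_B(y) with e = {x, y}, where the pairs (A, B) of vertex sets are functions
   of G taking at most 4^N values.  Every such pair carries at most 2 N ln 2 nats of
   information, so maximizing "information revealed minus a price per edge" over the
   sets S of edges yields |S| ln 2 <= eps n such that, given G restricted to S,
   revealing one more edge gives O(B N / (eps n)) further weighted nats.  By Pinsker,
   G_e and h_e are then nearly uncorrelated given G_S; since P(G_e = 1 | the rest) is
   the logistic function of h_e, which is increasing, it is close in L^2 to
   p_e = P(G_e = 1 | G_S).  Resampling the edges outside S one at a time as
   independent Bernoulli(p_e) moves G by at most the sum of these deviations, and the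
   resulting law is a mixture of product laws indexed by G_S, whose entropy is at most
   |S| ln 2. *)

(** * Logarithmic inequalities *)

Lemma ln_le_sub1 (R : realType) (x : R) : 0 < x -> ln x <= x - 1.
Proof.
move=> x0; have -> : x = 1 + (x - 1) by ring.
rewrite [leRHS]addrAC subrr add0r; apply: le_ln1Dx; lra.
Qed.

Lemma ln_ge_1subV (R : realType) (x : R) : 0 < x -> 1 - x^-1 <= ln x.
Proof.
move=> x0; have := ln_le_sub1 (x := x^-1); rewrite invr_gt0 lnV ?posrE// => /(_ x0); lra.
Qed.

(** Apply [ln x <= x - 1] at [x = sqrt p / sqrt r]; each relative entropy term then dominates the
    matching Hellinger term. *)
Lemma ln_term_ge (R : realType) (r p : R) : 0 <= r -> 0 < p ->
  2 * (r - Num.sqrt r * Num.sqrt p) <= r * (ln r - ln p).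
Proof.
rewrite le_eqVlt => /predU1P[<- p0|r0 p0]; first by rewrite sqrtr0 !mul0r subrr mulr0.
have sr0 : 0 < Num.sqrt r by rewrite sqrtr_gt0.
have sp0 : 0 < Num.sqrt p by rewrite sqrtr_gt0.
have rE : r = Num.sqrt r ^+ 2 by rewrite sqr_sqrtr ?ltW.
have pE : p = Num.sqrt p ^+ 2 by rewrite sqr_sqrtr ?ltW.
have lnE : ln r - ln p = - (2 * ln (Num.sqrt p / Num.sqrt r)).
  by rewrite ln_div ?posrE// {1}rE {1}pE !lnXn//; ring.
have := ln_le_sub1 (x := Num.sqrt p / Num.sqrt r); rewrite divr_gt0// => /(_ isT).
rewrite lnE; set L := ln _ => hL.
have -> : r - Num.sqrt r * Num.sqrt p = - (r * (Num.sqrt p / Num.sqrt r - 1)).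
  move: sr0 rE; move: (Num.sqrt r) => a a0 ->; field; exact: lt0r_neq0.
have : r * L <= r * (Num.sqrt p / Num.sqrt r - 1) by rewrite ler_wpM2l// ltW.
lra.
Qed.

(* [a, c] and [b, d] are the square roots of the two distributions; the relative entropy
   dominates the squared Hellinger distance [2 - 2 (a b + c d)], and
   [r - p = (a d - b c) (a d + b c)] with [(a d - b c)^2 = 1 - (a b + c d)^2]. *)
Lemma binary_kl_ge (R : realType) (r p : R) : 0 <= r <= 1 -> 0 < p < 1 ->
  (r - p) ^+ 2 <= r * (ln r - ln p) + (1 - r) * (ln (1 - r) - ln (1 - p)).
Proof.
move=> /andP[r0 r1] /andP[p0 p1].
have q0 : 0 < 1 - p by lra.
have s0 : 0 <= 1 - r by lra.
have := ln_term_ge r0 p0; have := ln_term_ge s0 q0.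
set K1 := (1 - r) * (_ - _); set K2 := r * (_ - _).
have rE : r = Num.sqrt r ^+ 2 by rewrite sqr_sqrtr.
have pE : p = Num.sqrt p ^+ 2 by rewrite sqr_sqrtr ?ltW.
have sE : 1 - r = Num.sqrt (1 - r) ^+ 2 by rewrite sqr_sqrtr.
have qE : 1 - p = Num.sqrt (1 - p) ^+ 2 by rewrite sqr_sqrtr ?ltW.
move: (sqrtr_ge0 r) (sqrtr_ge0 p) (sqrtr_ge0 (1 - r)) (sqrtr_ge0 (1 - p)).
move: (Num.sqrt r) (Num.sqrt p) (Num.sqrt (1 - r)) (Num.sqrt (1 - p)) rE pE sE qE.
move=> a b c d rE pE sE qE a0 b0 c0 d0 h1 h2.
have {sE} sE : c ^+ 2 = 1 - a ^+ 2 by rewrite -rE -sE.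
have {qE} qE : d ^+ 2 = 1 - b ^+ 2 by rewrite -pE -qE.
have e1 : r - p = (a * d - b * c) * (a * d + b * c).
  have -> : (a * d - b * c) * (a * d + b * c) = a ^+ 2 * d ^+ 2 - b ^+ 2 * c ^+ 2 by ring.
  rewrite sE qE -rE -pE; ring.
have e2 : (a * d - b * c) ^+ 2 = 1 - (a * b + c * d) ^+ 2.
  have -> : (a * d - b * c) ^+ 2 = a ^+ 2 * d ^+ 2 + b ^+ 2 * c ^+ 2 - 2 * (a*b*(c * d)) by ring.
  have -> : (a * b + c * d) ^+ 2 = a ^+ 2 * b ^+ 2 + c ^+ 2 * d ^+ 2 + 2 * (a*b*(c * d)) by ring.
  rewrite sE qE; ring.
have e3 : (a * d + b * c) ^+ 2 = 1 - (a * b - c * d) ^+ 2.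
  have -> : (a * d + b * c) ^+ 2 = a ^+ 2 * d ^+ 2 + b ^+ 2 * c ^+ 2 + 2 * (a*b*(c * d)) by ring.
  have -> : (a * b - c * d) ^+ 2 = a ^+ 2 * b ^+ 2 + c ^+ 2 * d ^+ 2 - 2 * (a*b*(c * d)) by ring.
  rewrite sE qE; ring.
have e4 : (r - p) ^+ 2 <= (a * d - b * c) ^+ 2.
  rewrite e1 exprMn ler_piMr ?sqr_ge0// e3; have := sqr_ge0 (a * b - c * d); lra.
apply: le_trans e4 _; rewrite e2.
have : 1 - (a * b + c * d) ^+ 2 <= 2 - 2 * (a * b + c * d).
  have := sqr_ge0 (1 - (a * b + c * d)); nra.
have : 2 - 2 * (a * b + c * d) = 2 * ((1 - r) - c * d) + 2 * (r - a * b) by ring.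
lra.
Qed.

(** * Conditional expectation and entropy on a finite probability space *)

Section Conditioning.
Variables (R : realType) (O : finType) (nu : O -> R).
Hypothesis nu_gt0 : forall g, 0 < nu g.

Let nu_ge0 g : 0 <= nu g. Proof. exact: ltW. Qed.

(* Conditioning is on the value of a key [k]. *)
Definition mass (T : eqType) (k : O -> T) (g : O) : R :=
  \sum_(g' | k g' == k g) nu g'.

Definition cexp (T : eqType) (k : O -> T) (F : O -> R) (g : O) : R :=
  (\sum_(g' | k g' == k g) nu g' * F g') / mass k g.

Lemma mass_gt0 (T : eqType) (k : O -> T) g : 0 < mass k g.
Proof.
rewrite /mass (bigD1 g)//= ltr_pwDl//.
by apply: sumr_ge0 => g' _.
Qed.

Lemma eq_mass (T T' : eqType) (k : O -> T) (k' : O -> T') g :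
  (forall g', (k g' == k g) = (k' g' == k' g)) -> mass k g = mass k' g.
Proof. by move=> kk'; apply: eq_bigl. Qed.

Lemma mass_congr (T : eqType) (k : O -> T) g g' : k g = k g' -> mass k g = mass k g'.
Proof. by rewrite /mass => ->. Qed.

Lemma cexp_congr (T : eqType) (k : O -> T) F g g' :
  k g = k g' -> cexp k F g = cexp k F g'.
Proof. by rewrite /cexp /mass => ->. Qed.

Lemma cexp_le (T : eqType) (k : O -> T) F F' g :
  (forall g', F g' <= F' g') -> cexp k F g <= cexp k F' g.
Proof.
move=> FF'; rewrite /cexp ler_wpM2r ?invr_ge0 ?(ltW (mass_gt0 _ _))//.
by apply: ler_sum => g' _; rewrite ler_wpM2l.
Qed.

Lemma cexp_cst (T : eqType) (k : O -> T) (c : R) g : cexp k (fun=> c) g = c.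
Proof. by rewrite /cexp -big_distrl/= mulrAC mulfV ?mul1r// gt_eqF// mass_gt0. Qed.

(** Exchanging the two sums moves the average onto [u], which is constant on each class of [k]: this
    is the tower property. *)
Lemma cexp_out (T : eqType) (k : O -> T) (u F : O -> R) :
  (forall g g', k g = k g' -> u g = u g') ->
  \sum_g nu g * (u g * cexp k F g) = \sum_g nu g * (u g * F g).
Proof.
move=> uk.
transitivity (\sum_g \sum_(g' | k g' == k g) nu g * u g / mass k g * (nu g' * F g')).
  by apply: eq_bigr => g _; rewrite -big_distrr/= /cexp; ring.
rewrite (exchange_big_dep xpredT)//=; apply: eq_bigr => g' _.
rewrite -big_distrl/=.
transitivity ((\sum_(g | k g' == k g) nu g) * (u g' / mass k g') * (nu g' * F g')).
  congr (_ * _); rewrite big_distrl/=; apply: eq_bigr => g /eqP kg.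
  by rewrite (uk _ _ kg) (mass_congr kg) mulrA.
under eq_bigl do rewrite eq_sym.
rewrite -/(mass k g'); field; by rewrite gt_eqF// mass_gt0.
Qed.

Definition prob_of (b : O -> bool) (g : O) : R := (b g)%:R.

(** Chain rule for one extra bit: the second factor is the conditional probability of the value that
    [b] takes at [g]. *)
Lemma mass_pair (T : eqType) (k : O -> T) (b : O -> bool) g :
  mass (fun g => (k g, b g)) g =
  mass k g * (if b g then cexp k (prob_of b) g else 1 - cexp k (prob_of b) g).
Proof.
have m0 : mass k g != 0 by rewrite gt_eqF// mass_gt0.
have rm : mass k g * cexp k (prob_of b) g = \sum_(g' | (k g' == k g) && b g') nu g'.
  rewrite /cexp mulrCA mulfV// mulr1 [RHS]big_mkcondr/=; apply: eq_bigr => g' _.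
  by rewrite /prob_of; case: (b g'); rewrite ?mulr1 ?mulr0.
have ms : mass k g = \sum_(g' | (k g' == k g) && b g') nu g' +
                     \sum_(g' | (k g' == k g) && ~~ b g') nu g'.
  by rewrite /mass (bigID b).
rewrite /mass; under eq_bigl do rewrite xpair_eqE.
rewrite -/(mass k g); case: ifP => bg.
  by rewrite rm; apply: eq_bigl => g'; case: (b g'); case: (b g) bg.
rewrite mulrBr mulr1 rm {1}ms addrAC subrr add0r.
by apply: eq_bigl => g'; case: (b g'); case: (b g) bg.
Qed.

Lemma cexp_prob_ge0 (T : eqType) (k : O -> T) (b : O -> bool) g : 0 <= cexp k (prob_of b) g.
Proof. by rewrite -(cexp_cst k 0 g) cexp_le// => g'; rewrite ler0n. Qed.

Lemma cexp_prob_le1 (T : eqType) (k : O -> T) (b : O -> bool) g : cexp k (prob_of b) g <= 1.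
Proof. by rewrite -(cexp_cst k 1 g) cexp_le// => g'; rewrite /prob_of lern1 leq_b1. Qed.

Lemma cexp_prob_in01 (T : eqType) (k : O -> T) (b : O -> bool) g g1 g0 :
  k g1 = k g -> b g1 -> k g0 = k g -> ~~ b g0 -> 0 < cexp k (prob_of b) g < 1.
Proof.
move=> k1 b1 k0 b0; apply/andP; split.
  have := mass_pair k b g1; rewrite b1 (cexp_congr _ k1) => e.
  by have := mass_gt0 (fun g => (k g, b g)) g1; rewrite e pmulr_rgt0// mass_gt0.
have := mass_pair k b g0; rewrite (negPf b0) (cexp_congr _ k0) => e.
by have := mass_gt0 (fun g => (k g, b g)) g0; rewrite e pmulr_rgt0 ?mass_gt0// subr_gt0.
Qed.

Hypothesis nu1 : \sum_g nu g = 1.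

(** The mean of [1 / mass k] is the number of nonempty classes, so [ln x <= x - 1] at
    [x = 1 / (mass k g * #|D|)] bounds the entropy of the key by [ln #|D|]. *)
Lemma sum_ln_mass_ge (T : finType) (k : O -> T) (D : {set T}) :
  (forall g, k g \in D) -> - ln #|D|%:R <= \sum_g nu g * ln (mass k g).
Proof.
move=> kD.
have D0 : 0 < #|D|%:R :> R.
  case: (pickP (fun _ : O => true)) => [g _|O0].
    by rewrite ltr0n card_gt0; apply/set0Pn; exists (k g).
  by move: nu1; rewrite big_pred0// => /esym/eqP; rewrite oner_eq0.
have classes : \sum_g nu g / mass k g <= #|D|%:R.
  rewrite (partition_big k (mem D))//= -sumr_const; apply: ler_sum => v _.
  set s := \sum_(g | k g == v) nu g.
  have -> : \sum_(g | k g == v) nu g / mass k g = s / s.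
    rewrite [in RHS]big_distrl/=; apply: eq_bigr => g /eqP kg.
    by rewrite /mass kg.
  by have [->|s0] := eqVneq s 0; [rewrite mul0r ler01 | rewrite divff].
have : \sum_g nu g * (- ln (mass k g) - ln #|D|%:R) <= 0.
  apply: (@le_trans _ _ (\sum_g nu g * ((mass k g * #|D|%:R)^-1 - 1))).
    apply: ler_sum => g _; rewrite ler_wpM2l//.
    have m0 := mass_gt0 k g.
    rewrite -opprD -lnM ?posrE// -lnV ?posrE ?mulr_gt0//.
    by apply: ln_le_sub1; rewrite invr_gt0 mulr_gt0.
  under eq_bigr do rewrite mulrBr mulr1 invfM mulrA.
  rewrite sumrB nu1 subr_le0 -big_distrl/= ler_pdivrMr// mul1r; exact: classes.
under eq_bigr do rewrite mulrBr mulrN.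
rewrite sumrB -big_distrl/= nu1 mul1r sumrN; lra.
Qed.

(* The conditional mutual information of [kf] and [b] given [k], when [kf] refines [k]. *)
Definition klgain (T T' : eqType) (kf : O -> T) (k : O -> T') (b : O -> bool) : R :=
  \sum_g nu g * (ln (mass (fun g => (kf g, b g)) g) - ln (mass kf g)
                 - (ln (mass (fun g => (k g, b g)) g) - ln (mass k g))).

(** Averaging the bit over the classes of [kf] turns the integrand of [klgain] into the relative
    entropy of two Bernoulli laws, to which [binary_kl_ge] applies pointwise. *)
Lemma klgain_ge (T T' : eqType) (kf : O -> T) (k : O -> T') (b : O -> bool) :
  (forall g g', kf g = kf g' -> k g = k g') ->
  (forall g, 0 < cexp k (prob_of b) g < 1) ->
  \sum_g nu g * (cexp kf (prob_of b) g - cexp k (prob_of b) g) ^+ 2 <= klgain kf k b.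
Proof.
move=> kfk p01; set r := cexp kf (prob_of b); set p := cexp k (prob_of b).
pose L1 g := ln (r g) - ln (p g); pose L0 g := ln (1 - r g) - ln (1 - p g).
have rc g g' : kf g = kf g' -> r g = r g' by exact: cexp_congr.
have pc g g' : kf g = kf g' -> p g = p g' by move=> /kfk; exact: cexp_congr.
have -> : klgain kf k b = \sum_g nu g * (r g * L1 g + (1 - r g) * L0 g).
  transitivity (\sum_g (nu g * ((L1 g - L0 g) * prob_of b g) + nu g * L0 g)).
    apply: eq_bigr => g _; rewrite -mulrDr; congr (_ * _).
    have := mass_gt0 (fun g => (kf g, b g)) g; have := mass_gt0 (fun g => (k g, b g)) g.
    rewrite !mass_pair -/(r g) -/(p g) /L1 /L0 /prob_of !pmulr_rgt0 ?mass_gt0//.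
    move: (r g) (p g) => x y; case: (b g) => h1 h2; rewrite !lnM ?posrE ?mass_gt0//=; ring.
  rewrite big_split/= -(cexp_out (k := kf)); last first.
    by move=> g g' e; rewrite /L1 /L0 (rc _ _ e) (pc _ _ e).
  rewrite -big_split/=; apply: eq_bigr => g _; rewrite -/(r g); ring.
apply: ler_sum => g _; rewrite ler_wpM2l//; apply: binary_kl_ge => //.
by rewrite cexp_prob_ge0 cexp_prob_le1.
Qed.

(** Since [M] is a function of [kf], the bit can be replaced by its conditional mean given [kf];
    then [2 |d| <= d ^ 2 / c + c] brings in the information gain, with [c] left free for tuning. *)
Lemma cov_le_klgain (T T' : eqType) (kf : O -> T) (k : O -> T') (b : O -> bool)
    (M : O -> R) (c : R) :
  (forall g g', kf g = kf g' -> k g = k g') ->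
  (forall g, 0 < cexp k (prob_of b) g < 1) ->
  (forall g g', kf g = kf g' -> M g = M g') -> (forall g, `|M g| <= 2) -> 0 < c ->
  \sum_g nu g * (M g * (prob_of b g - cexp k (prob_of b) g)) <= klgain kf k b / c + c.
Proof.
move=> kfk p01 Mk M2 c0.
under eq_bigr do rewrite mulrBr mulrBr.
rewrite sumrB -(cexp_out (k := kf))// -sumrB.
apply: (@le_trans _ _ (\sum_g (nu g * (cexp kf (prob_of b) g - cexp k (prob_of b) g) ^+ 2 / c + nu g * c))).
  apply: ler_sum => g _; rewrite -mulrBr -mulrA -mulrDr ler_wpM2l// -mulrBr.
  set d := _ - _; apply: le_trans (ler_norm _) _; rewrite normrM.
  have : `|M g| * `|d| <= 2 * `|d| by rewrite ler_wpM2r.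
  move=> /le_trans -> //; rewrite -real_normK ?num_real//.
  have -> : `|d| ^+ 2 / c + c = 2 * `|d| + (`|d| - c) ^+ 2 / c by field; rewrite gt_eqF.
  by rewrite lerDl divr_ge0 ?sqr_ge0// ltW.
rewrite big_split/= -!big_distrl/= nu1 mul1r lerD2r ler_pM2r ?invr_gt0//.
exact: klgain_ge.
Qed.

End Conditioning.

(** * Pinning coordinates *)

Lemma eq_in_set (E : finType) (A B : {set E}) : A = B -> A =i B.
Proof. by move=> ->. Qed.

Section Pinning.
Variables (R : realType) (E : finType) (nu : {set E} -> R).
Hypothesis nu_gt0 : forall g, 0 < nu g.
Hypothesis nu1 : \sum_g nu g = 1.

Let nu_ge0 g : 0 <= nu g. Proof. exact: ltW. Qed.

Definition pin (S g : {set E}) : {set E} := g :&: S.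

Definition contains (e : E) (g : {set E}) : bool := e \in g.

Definition pmean (S : {set E}) (e : E) (g : {set E}) : R :=
  cexp nu (pin S) (prob_of R (contains e)) g.

Definition logodds (e : E) (g : {set E}) : R := ln (nu (e |: g)) - ln (nu (g :\ e)).

(* The probability of [e] given all the other coordinates. *)
Definition glauber (e : E) (g : {set E}) : R := nu (e |: g) / (nu (e |: g) + nu (g :\ e)).

(** Pinning one more coordinate refines the key by one bit, which is the form in which [klgain]
    measures information. *)
Lemma pin_setU1 (S : {set E}) e (g g' : {set E}) :
  (pin (e |: S) g' == pin (e |: S) g) = ((pin S g', contains e g') == (pin S g, contains e g)).
Proof.
rewrite xpair_eqE /pin /contains; apply/eqP/andP => [h|[/eqP h /eqP he]].
  split; last by apply/eqP; have := eq_in_set h e; rewrite !inE eqxx !andbT.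
  apply/eqP/setP => x; have := eq_in_set h x; rewrite !inE.
  by case: (x \in S); rewrite ?orbT ?andbF ?andbT.
apply/setP => x; have := eq_in_set h x; rewrite !inE.
case: (eqVneq x e) => [->|_] //=; by rewrite !andbT he.
Qed.

Lemma pmean_in01 (S : {set E}) e g : e \notin S -> 0 < pmean S e g < 1.
Proof.
move=> eS; apply: (@cexp_prob_in01 _ _ _ _ _ _ _ _ (e |: g) (g :\ e)) => //.
- apply/setP => x; rewrite !inE; case: (eqVneq x e) => [->|] //.
  by rewrite (negPf eS) !andbF.
- by rewrite /contains !inE eqxx.
- apply/setP => x; rewrite !inE; case: (eqVneq x e) => [->|] //.
  by rewrite (negPf eS) !andbF.
- by rewrite /contains !inE eqxx.
Qed.

(* [S] maximizes the information revealed on the keys [V j] minus [mu] per pinned coordinate. *)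
Lemma exists_pins (T J : finType) (w : J -> R) (V : J -> {set E} -> T) (mu : R) :
  (forall j, 0 <= w j) -> 0 < mu ->
  exists S : {set E}, mu * #|S|%:R <= (\sum_j w j) * ln #|T|%:R /\
    forall e, e \notin S ->
      \sum_j w j * klgain nu (fun g => (V j g, pin S g)) (pin S) (contains e) <= mu.
Proof.
move=> w0 mu0.
(* [Psi S] is minus the weighted conditional entropy of the keys [V j] given [pin S]; its increment
   when [e] is pinned is the weighted sum of the [klgain]. *)
pose Psi S := \sum_j w j * \sum_g nu g *
  (ln (mass nu (fun g => (V j g, pin S g)) g) - ln (mass nu (pin S) g)).
have Psi_le0 S : Psi S <= 0.
  apply: sumr_le0 => j _; rewrite mulr_ge0_le0//; apply: sumr_le0 => g _.
  rewrite mulr_ge0_le0// subr_le0 ler_ln ?posrE ?mass_gt0//.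
  rewrite /mass [leRHS](bigID (fun g' => V j g' == V j g))/=.
  rewrite [X in X <= _](eq_bigl (fun g' => (pin S g' == pin S g) && (V j g' == V j g))).
    by rewrite lerDl; apply: sumr_ge0.
  by move=> g'; rewrite xpair_eqE andbC.
have Psi0 : - ((\sum_j w j) * ln #|T|%:R) <= Psi finset.set0.
  rewrite -mulrN big_distrl/=; apply: ler_sum => j _; rewrite ler_wpM2l//.
  have := @sum_ln_mass_ge _ _ _ nu_gt0 nu1 T (V j) finset.setT; rewrite cardsT.
  move=> /(_ (fun g => finset.in_setT _))/le_trans; apply; apply: ler_sum => g _.
  rewrite ler_wpM2l//.
  have -> : mass nu (pin finset.set0) g = 1.
    by rewrite /mass -[RHS]nu1; apply: eq_bigl => g'; rewrite /pin !finset.setI0 eqxx.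
  rewrite ln1 subr0 (eq_mass nu (k' := V j))// => g'.
  by rewrite xpair_eqE /pin !finset.setI0 eqxx andbT.
have step S e : Psi (e |: S) - Psi S =
    \sum_j w j * klgain nu (fun g => (V j g, pin S g)) (pin S) (contains e).
  rewrite /Psi -sumrB; apply: eq_bigr => j _; rewrite -mulrBr -sumrB; congr (_ * _).
  apply: eq_bigr => g _; rewrite -mulrBr.
  rewrite (eq_mass nu (k := pin (e |: S)) (k' := fun g => (pin S g, contains e g))); last first.
    by move=> g'; exact: pin_setU1.
  rewrite (eq_mass nu (k := fun g => (V j g, _)) (k' := fun g => ((V j g, pin S g), contains e g))).
    by congr (_ * _); ring.
  by move=> g'; rewrite !xpair_eqE pin_setU1 xpair_eqE andbA.
(* Comparing the maximizer with the empty set bounds its size; comparing it with [e |: S] bounds the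
   gain of [e]. *)
have [S _ Smax] := arg_maxP (P := xpredT) (fun S => Psi S - mu * #|S|%:R) (i0 := finset.set0) isT.
exists S; split.
  have := Smax finset.set0 isT; rewrite cards0 mulr0 subr0 /=.
  have := Psi_le0 S; lra.
move=> e eS; rewrite -step.
have := Smax (e |: S) isT; rewrite cardsU1 eS natrD mulrDr mulr1 /=; lra.
Qed.

(** The class of [g] under removal of [e] consists of exactly two sets, [e |: g] and [g :\ e]. *)
Lemma glauberE e g : glauber e g = cexp nu (fun g => g :\ e) (prob_of R (contains e)) g.
Proof.
have cls F : \sum_(g' | g' :\ e == g :\ e) F g' = F (e |: g) + F (g :\ e) :> R.
  have ne : g :\ e != e |: g.
    by apply/eqP => /setP/(_ e); rewrite !inE eqxx.
  rewrite (bigD1 (e |: g))/=; last first.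
    by apply/eqP/setP => x; rewrite !inE; case: eqVneq.
  congr (_ + _); rewrite (bigD1 (g :\ e))/=; last first.
    by rewrite ne andbT; apply/eqP/setP => x; rewrite !inE; case: eqVneq.
  rewrite big1 ?addr0// => g' /andP[/andP[/eqP h h1] h2].
  exfalso; have [eg|eg] := boolP (e \in g').
    by case/eqP: h1; rewrite -(finset.setD1K eg) h; apply/setP => x; rewrite !inE; case: eqVneq.
  by case/eqP: h2; rewrite -h; apply/setP => x; rewrite !inE; case: eqVneq eg => // -> /negPf.
by rewrite /glauber /cexp /mass !cls /prob_of /contains !inE eqxx /= mulr1 mulr0 addr0.
Qed.

Lemma glauber_in01 e g : 0 < glauber e g < 1.
Proof.
have := nu_gt0 (e |: g); have := nu_gt0 (g :\ e); rewrite /glauber.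
move: (nu (g :\ e)) (nu (e |: g)) => y x y0 x0; rewrite divr_gt0 ?addr_gt0//=.
by rewrite ltr_pdivrMr ?addr_gt0// mul1r ltrDl.
Qed.

Lemma logoddsE e g : logodds e g = ln (glauber e g) - ln (1 - glauber e g).
Proof.
have := nu_gt0 (e |: g); have := nu_gt0 (g :\ e); rewrite /glauber /logodds.
move: (nu (g :\ e)) (nu (e |: g)) => y x y0 x0.
have -> : 1 - x / (x + y) = y / (x + y) by field; rewrite gt_eqF ?addr_gt0.
rewrite !ln_div ?posrE ?addr_gt0//; ring.
Qed.

Lemma glauber_meanE e (F : {set E} -> R) :
  (forall g g', g :\ e = g' :\ e -> F g = F g') ->
  \sum_g nu g * (F g * glauber e g) = \sum_g nu g * (F g * prob_of R (contains e) g).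
Proof. by move=> Fe; rewrite -[RHS](cexp_out nu_gt0 _ Fe); apply: eq_bigr => g _; rewrite glauberE. Qed.

(** Both [ln s] and [- ln (1 - s)] have slope at least 1 on the unit interval, whence the factor
    2. *)
Lemma logit_diff_ge (s p : R) : 0 < s < 1 -> 0 < p < 1 ->
  2 * (s - p) ^+ 2 <= ((ln s - ln (1 - s)) - (ln p - ln (1 - p))) * (s - p).
Proof.
have lnd (a b : R) : 0 < a < 1 -> 0 < b < 1 -> (a - b) ^+ 2 <= (ln a - ln b) * (a - b).
  wlog ba : a b / b <= a.
    move=> H ha hb; case: (leP b a) => [/H|/ltW/H]; first exact.
    by move=> /(_ hb ha); nra.
  move=> /andP[a0 a1] /andP[b0 b1]; rewrite expr2 ler_wpM2r ?subr_ge0//.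
  have := @ln_ge_1subV R (a / b) (divr_gt0 a0 b0); rewrite ln_div ?posrE//.
  apply: le_trans; rewrite invf_div.
  have -> : 1 - b / a = (a - b) / a by field; rewrite gt_eqF.
  by rewrite ler_pdivlMr// ler_piMr ?subr_ge0// ltW.
move=> s01 p01; have := lnd _ _ s01 p01.
have := lnd (1 - s) (1 - p); rewrite ?(subr_gt0, ltrBlDr, ltrDl) => /(_ _ _)/=.
have -> : 1 - s - (1 - p) = - (s - p) by ring.
rewrite sqrrN; move: s01 p01 => /andP[-> ->] /andP[-> ->] /(_ isT isT); lra.
Qed.

(* Both [logodds] and the log-odds of [pmean] are orthogonal to the difference between the
   indicator of [e] and its conditional expectation, so the right-hand side equals the mean of
   [(logit s - logit p) (s - p)], where [s = glauber e] and [p = pmean S e]. *)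
Lemma glauber_var_le (S : {set E}) e : e \notin S ->
  2 * (\sum_g nu g * (glauber e g - pmean S e g) ^+ 2) <=
  \sum_g nu g * (logodds e g * (prob_of R (contains e) g - pmean S e g)).
Proof.
move=> eS; pose a g := ln (pmean S e g) - ln (1 - pmean S e g).
have he g g' : g :\ e = g' :\ e -> logodds e g = logodds e g'.
  have U (x : {set E}) : e |: x = e |: (x :\ e) by apply/setP => y; rewrite !inE; case: eqVneq.
  by move=> h; rewrite /logodds U h -U.
have ap g g' : pin S g = pin S g' -> a g = a g'.
  by move=> h; rewrite /a /pmean (cexp_congr _ _ h).
have ae g g' : g :\ e = g' :\ e -> a g = a g'.
  move=> h; apply: ap; apply/setP => x; rewrite !inE.
  have := eq_in_set h x; rewrite !inE; case: eqVneq => [->|]/=; last by move=> _ ->.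
  by rewrite (negPf eS) !andbF.
have -> : \sum_g nu g * (logodds e g * (prob_of R (contains e) g - pmean S e g)) =
  \sum_g nu g * ((logodds e g - a g) * (glauber e g - pmean S e g)).
  have e1 := glauber_meanE he; have e2 := glauber_meanE ae.
  have e3 := cexp_out nu_gt0 (prob_of R (contains e)) ap.
  rewrite -/(pmean S e) in e3.
  transitivity (\sum_g nu g * (logodds e g * prob_of R (contains e) g)
     - \sum_g nu g * (logodds e g * pmean S e g)
     - (\sum_g nu g * (a g * prob_of R (contains e) g) - \sum_g nu g * (a g * pmean S e g))).
    rewrite [X in _ - (_ - X)]e3 subrr subr0 -sumrB; apply: eq_bigr => g _; ring.
  rewrite -e1 -e2 -!sumrB; apply: eq_bigr => g _; ring.
rewrite big_distrr/=; apply: ler_sum => g _; rewrite mulrCA ler_wpM2l//.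
by rewrite logoddsE; apply: logit_diff_ge; [exact: glauber_in01 | exact: pmean_in01].
Qed.

(** In [glauber_var_le], split the log-odds into the weighted functions of the keys, handled by
    [cov_le_klgain], and an error; the error is multiplied by a deviation of absolute value at most
    1, so in total it costs at most [Delta]. *)
Lemma sum_glauber_var_le (T J : finType) (w : J -> R) (V : J -> {set E} -> T)
    (M : J -> E -> T -> R) (mu c Delta : R) (S : {set E}) :
  (forall j, 0 <= w j) -> 0 < c -> 0 <= mu ->
  (forall e, e \notin S ->
      \sum_j w j * klgain nu (fun g => (V j g, pin S g)) (pin S) (contains e) <= mu) ->
  (forall j e v, `|M j e v| <= 2) ->
  (forall g, \sum_e `|logodds e g - \sum_j w j * M j e (V j g)| <= Delta) ->
  2 * (\sum_(e | e \notin S) \sum_g nu g * (glauber e g - pmean S e g) ^+ 2) <=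
  #|E|%:R * (mu / c + (\sum_j w j) * c) + Delta.
Proof.
move=> w0 c0 mu0 Smu M2 errD.
pose err e g := logodds e g - \sum_j w j * M j e (V j g).
have dif_le1 S' e g : `|prob_of R (contains e) g - pmean S' e g| <= 1.
  have := @cexp_prob_ge0 _ _ nu nu_gt0 _ (pin S') (contains e) g.
  have := @cexp_prob_le1 _ _ nu nu_gt0 _ (pin S') (contains e) g.
  rewrite -/(pmean S' e g) /prob_of ler_norml.
  by case: (contains e g); rewrite /=; lra.
have one e : e \notin S ->
    2 * (\sum_g nu g * (glauber e g - pmean S e g) ^+ 2) <=
    mu / c + (\sum_j w j) * c + \sum_g nu g * `|err e g|.
  move=> eS; apply: le_trans (glauber_var_le eS) _.
  have -> : \sum_g nu g * (logodds e g * (prob_of R (contains e) g - pmean S e g)) =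
     \sum_j w j * \sum_g nu g * (M j e (V j g) * (prob_of R (contains e) g - pmean S e g))
     + \sum_g nu g * (err e g * (prob_of R (contains e) g - pmean S e g)).
    under [X in _ = X + _]eq_bigr do rewrite big_distrr/=.
    rewrite exchange_big -big_split/=; apply: eq_bigr => g _.
    have -> : logodds e g = \sum_j w j * M j e (V j g) + err e g by rewrite /err; ring.
    rewrite mulrDl mulrDr; congr (_ + _); rewrite big_distrl big_distrr/=.
    by apply: eq_bigr => j _; ring.
  apply: lerD; last first.
    apply: ler_sum => g _; rewrite ler_wpM2l// (le_trans (ler_norm _))// normrM.
    by rewrite ler_piMr.
  apply: (@le_trans _ _ (\sum_j (w j * klgain nu (fun g => (V j g, pin S g)) (pin S) (contains e) / c + w j * c))).
    apply: ler_sum => j _; rewrite -mulrA -mulrDr ler_wpM2l//.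
    apply: cov_le_klgain => //; first by move=> g g' [].
      by move=> g; exact: pmean_in01.
    by move=> g g' [->].
  by rewrite big_split/= -!big_distrl/= lerD2r ler_pM2r ?invr_gt0// Smu.
rewrite big_distrr/=.
(* The individual bounds are nonnegative, so the sum may be extended to the pinned coordinates. *)
apply: (@le_trans _ _ (\sum_e (mu / c + (\sum_j w j) * c + \sum_g nu g * `|err e g|))).
  rewrite [leRHS](bigID (fun e => e \notin S))/=.
  have X0 e : 0 <= mu / c + (\sum_j w j) * c + \sum_g nu g * `|err e g|.
    rewrite !addr_ge0 ?divr_ge0 ?mulr_ge0 ?sumr_ge0 ?(ltW c0)// => g _.
    by rewrite mulr_ge0.
  apply: (@le_trans _ _ (\sum_(e | e \notin S) (mu / c + (\sum_j w j) * c + \sum_g nu g * `|err e g|))).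
    by apply: ler_sum => e eS; exact: one.
  by rewrite lerDl sumr_ge0.
rewrite big_split/= sumr_const -[(_ + _) *+ _]mulr_natl lerD2l exchange_big/=.
under eq_bigr do rewrite -big_distrr/=.
apply: (@le_trans _ _ (\sum_g nu g * Delta)); last by rewrite -big_distrl/= nu1 mul1r.
by apply: ler_sum => g _; rewrite ler_wpM2l// errD.
Qed.

(** Cauchy-Schwarz, obtained by evaluating a nonnegative quadratic in [tau] at [tau = W / n]. *)
Lemma sum_glauber_dev_le (S : {set E}) :
  (\sum_(e | e \notin S) \sum_g nu g * `|glauber e g - pmean S e g|) ^+ 2 <=
  #|E|%:R * \sum_(e | e \notin S) \sum_g nu g * (glauber e g - pmean S e g) ^+ 2.
Proof.
set W := \sum_(e | _) \sum_g nu g * `|_|; set Q := \sum_(e | _) _.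
have [E0|] := eqVneq #|E| 0%N.
  have -> : W = 0.
    by apply: big_pred0 => e; have := fintype0 e; rewrite E0 => /(_ erefl).
  by rewrite E0 mul0r expr0n.
rewrite -lt0n -(ltr0n R) => n0; set n := #|E|%:R in n0 *.
have key tau : 0 <= Q - 2 * tau * W + n * tau ^+ 2.
  apply: (@le_trans _ _ (\sum_(e | e \notin S) \sum_g nu g * (`|glauber e g - pmean S e g| - tau) ^+ 2)).
    by apply: sumr_ge0 => e _; apply: sumr_ge0 => g _; rewrite mulr_ge0// sqr_ge0.
  apply: (@le_trans _ _ (Q - 2 * tau * W + \sum_(e | e \notin S) tau ^+ 2)).
    rewrite /Q /W big_distrr/= -sumrB -big_split/=; apply: ler_sum => e _.
    rewrite big_distrr/= -sumrB -[X in _ + X]mul1r -[X in X * tau ^+ 2]nu1 big_distrl -big_split/=.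
    apply: ler_sum => g _; rewrite -(real_normK (num_real (glauber e g - _))).
    by rewrite le_eqVlt; apply/orP; left; apply/eqP; ring.
  rewrite lerD2l sumr_const -mulr_natl ler_wpM2r ?sqr_ge0// ler_nat.
  exact: max_card.
have := key (W / n).
have -> : Q - 2 * (W / n) * W + n * (W / n) ^+ 2 = (n * Q - W ^+ 2) / n.
  by field; rewrite gt_eqF.
by rewrite pmulr_lge0 ?invr_gt0// subr_ge0.
Qed.

End Pinning.

(** * Couplings and resampling *)

Section SetPairs.
Variables (R : realType) (E : finType).
Implicit Types (e : E) (g : {set E}).

Lemma setU1D1 e g : e |: (g :\ e) = e |: g.
Proof. by apply/setP => x; rewrite !inE; case: eqVneq. Qed.

Lemma setU1U1 e g : e |: (e |: g) = e |: g.
Proof. by apply/setP => x; rewrite !inE; case: eqVneq. Qed.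

Lemma setD1U1 e g : (e |: g) :\ e = g :\ e.
Proof. by apply/setP => x; rewrite !inE; case: eqVneq. Qed.

Lemma setD1D1 e g : (g :\ e) :\ e = g :\ e.
Proof. by apply/setP => x; rewrite !inE; case: eqVneq. Qed.

Lemma setU1_in e g : e \in g -> e |: g = g.
Proof. by move=> eg; apply/setP => x; rewrite !inE; case: eqVneq => [->|]. Qed.

Lemma setD1_notin e g : e \notin g -> g :\ e = g.
Proof. by move=> eg; apply/setP => x; rewrite !inE; case: eqVneq => [->|]; rewrite ?(negPf eg). Qed.

(** Sets are grouped in pairs differing at [e], each pair being represented by its member without
    [e]. *)
Lemma sum_set_pairs e (X : {set E} -> R) :
  \sum_g X g = \sum_(g : {set E} | e \notin g) (X (e |: g) + X (g :\ e)).
Proof.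
rewrite (bigID (fun g : {set E} => e \in g))/= big_split/=; congr (_ + _); last first.
  by apply: eq_bigr => g eg; rewrite setD1_notin.
rewrite (reindex_onto (fun g : {set E} => e |: g) (fun g => g :\ e))/=; last first.
  by move=> g eg; rewrite setU1D1 setU1_in.
apply: eq_bigl => g; rewrite !inE eqxx/= setD1U1.
apply/eqP/idP => [<-|eg]; first by rewrite !inE eqxx.
by rewrite setD1_notin.
Qed.

End SetPairs.

Section Couplings.
Variables (R : realType) (E : finType).
Implicit Types (g : {set E}) (q : {set E} -> R).

Definition symdist g g' : nat := #|(g :\: g') :|: (g' :\: g)|.

Lemma symdist_triangle g1 g2 g3 :
  (symdist g1 g3 <= symdist g1 g2 + symdist g2 g3)%N.
Proof.
apply: leq_trans (leq_card_setU _ _); apply: subset_leq_card.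
apply/fintype.subsetP => x; rewrite !inE.
by case: (x \in g1); case: (x \in g2); case: (x \in g3).
Qed.

Lemma symdistxx g : symdist g g = 0%N.
Proof. by apply/eqP; rewrite cards_eq0; apply/eqP/setP => x; rewrite !inE; case: (x \in g). Qed.

(** A bound on the transport cost from [q1] to [q2] for the Hamming distance. *)
Definition coupled q1 q2 (C : R) : Prop :=
  exists mu : {set E} * {set E} -> R,
    [/\ forall gg, 0 <= mu gg, forall g, \sum_g' mu (g, g') = q1 g,
        forall g', \sum_g mu (g, g') = q2 g' &
        \sum_gg mu gg * (symdist gg.1 gg.2)%:R <= C].

Lemma coupled_refl q : (forall g, 0 <= q g) -> coupled q q 0.
Proof.
move=> q0; exists (fun gg => if gg.1 == gg.2 then q gg.1 else 0); split => /=.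
- by move=> gg; case: ifP.
- move=> g; rewrite (bigD1 g)//= eqxx big1 ?addr0// => g' /negPf.
  by rewrite eq_sym => ->.
- by move=> g; rewrite (bigD1 g)//= eqxx big1 ?addr0// => g' /negPf ->.
- rewrite big1// => -[g g'] _ /=; case: eqP => [->|_]; last by rewrite mul0r.
  by rewrite symdistxx mulr0.
Qed.

(** Gluing: make the outer coordinates conditionally independent given the middle one, then use the
    triangle inequality. *)
Lemma coupled_trans q1 q2 q3 C C' :
  coupled q1 q2 C -> coupled q2 q3 C' -> coupled q1 q3 (C + C').
Proof.
move=> [m1 [m10 m11 m12 m1C]] [m2 [m20 m21 m22 m2C]].
(* Where [q2] vanishes, the quotient below is 0 by convention; this is harmless because both
   couplings vanish there too. *)
have z1 h : q2 h = 0 -> forall g, m1 (g, h) = 0.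
  rewrite -m12 => /eqP; rewrite psumr_eq0// => /allP H g.
  by apply/eqP/(implyP (H g _)); rewrite ?mem_index_enum.
have z2 h : q2 h = 0 -> forall g, m2 (h, g) = 0.
  rewrite -m21 => /eqP; rewrite psumr_eq0// => /allP H g.
  by apply/eqP/(implyP (H g _)); rewrite ?mem_index_enum.
have q20 h : 0 <= q2 h by rewrite -m12 sumr_ge0.
have r1 g h : \sum_k m1 (g, h) * m2 (h, k) / q2 h = m1 (g, h).
  rewrite -big_distrl -big_distrr/= m21.
  have [q0|q0] := eqVneq (q2 h) 0; first by rewrite (z1 _ q0) !mul0r.
  by rewrite mulfK.
have r2 k h : \sum_g m1 (g, h) * m2 (h, k) / q2 h = m2 (h, k).
  rewrite -!big_distrl/= m12.
  have [q0|q0] := eqVneq (q2 h) 0; first by rewrite (z2 _ q0) mulr0 mul0r.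
  by rewrite mulrAC divff ?mul1r.
exists (fun gg => \sum_h m1 (gg.1, h) * m2 (h, gg.2) / q2 h); split => /=.
- by move=> gg; apply: sumr_ge0 => h _; rewrite divr_ge0 ?mulr_ge0.
- by move=> g; rewrite exchange_big/= -m11; apply: eq_bigr => h _.
- by move=> g; rewrite exchange_big/= -m22; apply: eq_bigr => h _.
pose t g h k := m1 (g, h) * m2 (h, k) / q2 h.
have t0 g h k : 0 <= t g h k by rewrite divr_ge0 ?mulr_ge0.
apply: (@le_trans _ _ (\sum_g \sum_k \sum_h t g h k * ((symdist g h)%:R + (symdist h k)%:R))).
  rewrite pair_big/=; apply: ler_sum => -[g k] _ /=; rewrite big_distrl/=.
  by apply: ler_sum => h _; rewrite -/(t g h k) ler_wpM2l// -natrD ler_nat symdist_triangle.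
have -> : \sum_g \sum_k \sum_h t g h k * ((symdist g h)%:R + (symdist h k)%:R) =
  \sum_g \sum_h (\sum_k t g h k) * (symdist g h)%:R +
  \sum_h \sum_k (\sum_g t g h k) * (symdist h k)%:R.
  transitivity (\sum_g \sum_h \sum_k t g h k * (symdist g h)%:R +
                \sum_g \sum_h \sum_k t g h k * (symdist h k)%:R).
    rewrite -big_split/=; apply: eq_bigr => g _; rewrite exchange_big/= -big_split/=.
    apply: eq_bigr => h _; rewrite -big_split/=; apply: eq_bigr => k _; exact: mulrDr.
  congr (_ + _).
    by apply: eq_bigr => g _; apply: eq_bigr => h _; rewrite big_distrl.
  rewrite exchange_big/=; apply: eq_bigr => h _; rewrite exchange_big/=.
  by apply: eq_bigr => k _; rewrite big_distrl.
apply: lerD.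
  apply: le_trans m1C; rewrite pair_big/=; apply: ler_sum => -[g h] _ /=.
  by rewrite /t r1.
apply: le_trans m2C; rewrite pair_big/=; apply: ler_sum => -[h k] _ /=.
by rewrite /t r2.
Qed.

Lemma coupled_le q1 q2 C C' : C <= C' -> coupled q1 q2 C -> coupled q1 q2 C'.
Proof. by move=> CC' [m [? ? ? h]]; exists m; split => //; exact: le_trans CC'. Qed.

Definition flip (e : E) g := if e \in g then g :\ e else e |: g.

Lemma flipK e : involutive (flip e).
Proof.
move=> g; rewrite /flip; case: (boolP (e \in g)) => eg.
  by rewrite !inE eqxx/= setU1D1 setU1_in.
by rewrite !inE eqxx/= setD1U1 setD1_notin.
Qed.

Lemma flip_neq e g : (flip e g == g) = false.
Proof.
apply/eqP => /eq_in_set/(_ e); rewrite /flip.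
by case: (boolP (e \in g)) => eg; rewrite !inE eqxx// (negPf eg).
Qed.

Lemma symdist_flip e g : symdist g (flip e g) = 1%N.
Proof.
apply/eqP/cards1P; exists e; apply/setP => x; rewrite /flip.
case: (boolP (e \in g)) => eg; rewrite !inE; case: eqVneq => [->|_] /=.
- by rewrite eg.
- by case: (x \in g).
- by rewrite (negPf eg).
- by case: (x \in g).
Qed.

(** Leave [min (q1 g) (q2 g)] in place and send the excess of [q1] to the flipped set: as each pair
    has the same total mass under both laws, the excess at one member is the deficit at the
    other. *)
Lemma coupled_flip (e : E) q1 q2 :
  (forall g, 0 <= q1 g) -> (forall g, 0 <= q2 g) ->
  (forall g, q1 (flip e g) + q1 g = q2 (flip e g) + q2 g) ->
  coupled q1 q2 (\sum_g `|q1 g - q2 g|).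
Proof.
move=> q10 q20 q12.
pose excess g := Num.max (q1 g - q2 g) 0.
exists (fun gg => if gg.2 == gg.1 then Num.min (q1 gg.1) (q2 gg.1)
                  else if gg.2 == flip e gg.1 then excess gg.1 else 0); split => /=.
- move=> [g g'] /=; case: ifP => _; first by rewrite le_min q10 q20.
  by case: ifP => // _; rewrite le_max lexx orbT.
- move=> g; rewrite (bigD1 g)//= eqxx (bigD1 (flip e g))/= ?flip_neq// eqxx.
  rewrite big1 ?addr0; last by move=> g' /andP[/negPf -> /negPf ->].
  rewrite /excess minEle maxEle; case: leP => h1; case: leP => h2; lra.
- move=> g; rewrite (bigD1 g)//= eqxx (bigD1 (flip e g))/= ?flip_neq//.
  rewrite eq_sym flip_neq flipK eqxx.
  rewrite big1 ?addr0; last first.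
    move=> g' /andP[gg' fg]; rewrite eq_sym (negPf gg').
    case: eqP => // gfg; move: fg; by rewrite gfg flipK eqxx.
  rewrite /excess minEle maxEle; have h3 := q12 g; case: leP => h1; case: leP => h2; lra.
rewrite (eq_bigr (fun gg : {set E} * {set E} => if gg.2 == flip e gg.1 then excess gg.1 else 0)); last first.
  move=> [g g'] _ /=; case: (eqVneq g' g) => [->|gg'].
    by rewrite symdistxx mulr0 eq_sym flip_neq.
  by case: eqP => [->|]; rewrite ?symdist_flip ?mulr1 ?mul0r.
rewrite -(pair_big xpredT xpredT (fun g g' => if g' == flip e g then excess g else 0))/=.
apply: ler_sum => g _; rewrite -big_mkcond/= big_pred1_eq /excess.
by rewrite ge_max ler_norm normr_ge0.
Qed.

End Couplings.

(** * Resampling operators and the mixtures of product laws that they produce *)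

Section Resampling.
Variables (R : realType) (E : finType) (S : {set E}) (p : E -> {set E} -> R).
Hypothesis p_pin : forall e g g', pin S g = pin S g' -> p e g = p e g'.
Hypothesis p01 : forall e g, e \notin S -> 0 < p e g < 1.
Implicit Types (e : E) (g : {set E}) (F : {set E} -> R).

Definition bern (x : R) (b : bool) : R := if b then x else 1 - x.

(** The action on laws of a Markov step: forget coordinate [e], then redraw it with mean [p e g]. *)
Definition resample e F g : R := (F (e |: g) + F (g :\ e)) * bern (p e g) (e \in g).

Definition resamples (es : seq E) F := foldr resample F es.

Lemma pin_setU1_out e g : e \notin S -> pin S (e |: g) = pin S g.
Proof. by move=> eS; apply/setP => x; rewrite !inE; case: eqVneq => [->|] //; rewrite (negPf eS) !andbF. Qed.

Lemma pin_setD1_out e g : e \notin S -> pin S (g :\ e) = pin S g.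
Proof. by move=> eS; apply/setP => x; rewrite !inE; case: eqVneq => [->|] //; rewrite (negPf eS) !andbF. Qed.

Lemma pU e e' g : e' \notin S -> p e (e' |: g) = p e g.
Proof. by move=> eS; apply: p_pin; exact: pin_setU1_out. Qed.

Lemma pD e e' g : e' \notin S -> p e (g :\ e') = p e g.
Proof. by move=> eS; apply: p_pin; exact: pin_setD1_out. Qed.

Lemma bern_ge0 e g b : e \notin S -> 0 <= bern (p e g) b.
Proof. by move=> eS; have /andP[h0 h1] := p01 g eS; rewrite /bern; case: b; lra. Qed.

Lemma resample_ge0 e F : e \notin S -> (forall g, 0 <= F g) -> forall g, 0 <= resample e F g.
Proof. by move=> eS F0 g; rewrite mulr_ge0 ?addr_ge0 ?bern_ge0. Qed.

(** The means depend on pinned coordinates only, so redrawing one free coordinate leaves the mean of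
    the other unchanged. *)
Lemma resampleC e e' F : e \notin S -> e' \notin S ->
  resample e (resample e' F) = resample e' (resample e F).
Proof.
move=> eS e'S; have [->//|ee'] := eqVneq e e'.
have e'e : (e' == e) = false by rewrite eq_sym (negPf ee').
have UU g : e' |: (e |: g) = e |: (e' |: g) by apply/setP => x; rewrite !inE orbCA.
have DD g : (g :\ e) :\ e' = (g :\ e') :\ e by apply/setP => x; rewrite !inE andbCA.
have UD g : e' |: (g :\ e) = (e' |: g) :\ e.
  by apply/setP => x; rewrite !inE; case: (eqVneq x e') => [->|] //=; rewrite e'e.
have DU g : (e |: g) :\ e' = e |: (g :\ e').
  by apply/setP => x; rewrite !inE; case: (eqVneq x e) => [->|] //=; rewrite ee'.
apply/funext => g; rewrite /resample !pU// !pD// !inE (negPf ee') e'e/=.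
rewrite UU UD DU DD; ring.
Qed.

(** The adjoint action on test functions, read off on each pair of sets differing at [e]. *)
Lemma sum_resample e F (f : {set E} -> R) : e \notin S ->
  \sum_g resample e F g * f g =
  \sum_g F g * (p e g * f (e |: g) + (1 - p e g) * f (g :\ e)).
Proof.
move=> eS; rewrite [LHS](sum_set_pairs e) [RHS](sum_set_pairs e).
apply: eq_bigr => g eg; rewrite /resample setU1U1 setU1D1 setD1U1 setD1D1.
by rewrite !pU// !pD// /bern !inE eqxx/=; ring.
Qed.

Lemma sum_resample_inv e F (f : {set E} -> R) : e \notin S ->
  (forall g, f (e |: g) = f g) -> (forall g, f (g :\ e) = f g) ->
  \sum_g resample e F g * f g = \sum_g F g * f g.
Proof.
move=> eS fU fD; rewrite sum_resample//; apply: eq_bigr => g _.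
by rewrite fU fD; ring.
Qed.

Lemma sum_resamples_inv es F (f : {set E} -> R) : {in es, forall e, e \notin S} ->
  {in es, forall e g, f (e |: g) = f g} -> {in es, forall e g, f (g :\ e) = f g} ->
  \sum_g resamples es F g * f g = \sum_g F g * f g.
Proof.
elim: es => [//|e es IH] eS fU fD /=.
rewrite sum_resample_inv ?eS ?mem_head//.
- by apply: IH => e' he'; [apply: eS|apply: fU|apply: fD]; rewrite inE he' orbT.
- by apply: fU; rewrite mem_head.
- by apply: fD; rewrite mem_head.
Qed.

(** By commutation any chosen coordinate can be redrawn first. *)
Lemma resamples_rem e es F : {in es, forall e, e \notin S} -> e \in es ->
  resamples es F = resamples (rem e es) (resample e F).
Proof.
elim: es => [//|e' es IH] eS /=; rewrite inE; case: (eqVneq e' e) eS => [->|ne] eS; last first.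
  move=> /= ees; rewrite IH// => x xs.
  by apply: eS; rewrite inE xs orbT.
move=> _; rewrite ?eqxx; elim: es eS {IH} => [//|e'' es IH] eS /=.
rewrite resampleC ?eS ?inE ?eqxx ?orbT//; congr (resample _ _); apply: IH.
move=> x; rewrite inE => /orP[/eqP ->|xs]; apply: eS; rewrite !inE ?eqxx// xs !orbT//.
Qed.

Lemma resampleB e F F' g :
  resample e F g - resample e F' g = resample e (fun g => F g - F' g) g.
Proof. by rewrite /resample; ring. Qed.

(** A Markov step is dominated by its action on [|F|] and preserves total mass. *)
Lemma l1_resample_le e F : e \notin S -> \sum_g `|resample e F g| <= \sum_g `|F g|.
Proof.
move=> eS; apply: (@le_trans _ _ (\sum_g resample e (fun g => `|F g|) g * 1)).
  apply: ler_sum => g _; rewrite mulr1 /resample normrM (ger0_norm (bern_ge0 _ _ eS)).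
  by rewrite ler_wpM2r ?bern_ge0// ler_normD.
by rewrite sum_resample_inv//; under eq_bigr do rewrite mulr1.
Qed.

Lemma l1_resamples_le es F F' : {in es, forall e, e \notin S} ->
  \sum_g `|resamples es F g - resamples es F' g| <= \sum_g `|F g - F' g|.
Proof.
elim: es => [//|e es IH] eS /=; apply: le_trans (IH _); last first.
  by move=> x xs; apply: eS; rewrite inE xs orbT.
under eq_bigr do rewrite resampleB; apply: l1_resample_le.
by apply: eS; rewrite mem_head.
Qed.

Lemma coupled_resample e F : e \notin S -> (forall g, 0 <= F g) ->
  coupled F (resample e F) (\sum_g `|F g - resample e F g|).
Proof.
move=> eS F0; apply: (coupled_flip (e := e)) => //; first exact: resample_ge0.
move=> g; rewrite /flip /resample; case: (boolP (e \in g)) => eg.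
  rewrite !setU1D1 !setD1D1 !inE eqxx/= pD// (setU1_in eg); rewrite /bern; ring.
rewrite !setU1U1 !setD1U1 !inE eqxx/= pU// (setD1_notin eg); rewrite /bern; ring.
Qed.

(* The resampling operators commute and contract the L^1 norm, so every step costs at most
   what it would cost if it were performed first. *)
Lemma coupled_resamples es F : {in es, forall e, e \notin S} -> (forall g, 0 <= F g) ->
  coupled F (resamples es F) (\sum_(e <- es) \sum_g `|F g - resample e F g|).
Proof.
move=> eS F0; suff: (forall g, 0 <= resamples es F g) /\
    coupled F (resamples es F) (\sum_(e <- es) \sum_g `|F g - resample e F g|) by case.
elim: es eS => [|e es IH] eS /=; first by rewrite big_nil; split => //; exact: coupled_refl.
have eS' : {in es, forall e, e \notin S} by move=> x xs; apply: eS; rewrite inE xs orbT.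
have ee : e \notin S by apply: eS; rewrite mem_head.
have [q0 c0] := IH eS'; split; first exact: resample_ge0.
rewrite big_cons addrC; apply: coupled_trans c0 _.
apply: coupled_le (coupled_resample ee q0).
(* Moving the new step to the innermost position allows the contraction to be applied to the
   remaining ones. *)
have -> : resample e (resamples es F) = resamples es (resample e F).
  have := @resamples_rem e (e :: es) F eS (mem_head _ _); by rewrite /= eqxx.
exact: l1_resamples_le.
Qed.

Definition product_law (a : E -> R) g : R := \prod_e bern (a e) (e \in g).

(** The marginals of the product law obtained by resampling [es] from the point mass at [x]. *)
Definition resampled_field (es : seq E) (x : {set E}) e : R :=
  if e \in es then p e x else (e \in x)%:R.

Lemma bern_indicator (b b' : bool) : bern b%:R b' = (b == b')%:R.
Proof. by case: b; case: b'; rewrite /bern /= ?subrr ?subr0. Qed.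

Lemma product_law_pairs e (a : E -> R) g :
  product_law a (e |: g) + product_law a (g :\ e) =
  \prod_(e' | e' != e) bern (a e') (e' \in g).
Proof.
rewrite /product_law (bigD1 e)//= [X in _ + X](bigD1 e)//= !inE eqxx/=.
rewrite (eq_bigr (fun e' => bern (a e') (e' \in g))); last by move=> e' /negPf h; rewrite !inE h.
rewrite [X in _ + _ * X](eq_bigr (fun e' => bern (a e') (e' \in g))); last first.
  by move=> e' h; rewrite !inE h.
by rewrite /bern; ring.
Qed.

Lemma prod_pin_eq0 (A : pred E) (a : E -> R) (x g : {set E}) :
  (forall e, e \in S -> A e) -> (forall e, e \in S -> a e = (e \in x)%:R) ->
  pin S x != pin S g -> \prod_(e | A e) bern (a e) (e \in g) = 0.
Proof.
move=> SA aS /eqP xg; have [e eS exg] : exists2 e, e \in S & (e \in x) != (e \in g).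
  apply/exists_inP; apply: contra_notT xg; rewrite negb_exists_in => /forall_inP H.
  apply/setP => e; rewrite !inE; case: (boolP (e \in S)); rewrite ?andbF// => /H.
  by rewrite negbK => /eqP ->.
by rewrite (bigD1 e) ?SA//= aS// bern_indicator (negPf exg) mul0r.
Qed.

(** By induction: a new step sums out coordinate [e] of each product law and puts a Bernoulli factor
    in its place. *)
Lemma resamples_mixture es F : uniq es -> {in es, forall e, e \notin S} ->
  forall g, resamples es F g = \sum_x F x * product_law (resampled_field es x) g.
Proof.
elim: es => [_ _ g|e es IH /= /andP[ees ues] eS g] /=.
  rewrite (bigD1 g)//= big1 ?addr0 => [|x xg].
    by rewrite /product_law big1 ?mulr1// => e _; rewrite bern_indicator eqxx.
  suff -> : product_law (resampled_field [::] x) g = 0 by rewrite mulr0.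
  have [e exg] : exists e, (e \in x) != (e \in g).
    apply/existsP; apply: contraNT xg; rewrite negb_exists => /forallP H.
    by apply/eqP/setP => e; apply/eqP; rewrite -[_ == _]negbK H.
  by rewrite /product_law (bigD1 e)//= bern_indicator (negPf exg) mul0r.
have eS' : {in es, forall e, e \notin S} by move=> x xs; apply: eS; rewrite inE xs orbT.
have ee : e \notin S by apply: eS; rewrite mem_head.
rewrite /resample !IH// -big_split big_distrl/=; apply: eq_bigr => x _.
rewrite -mulrDr -mulrA product_law_pairs; congr (_ * _).
rewrite mulrC [in RHS]/product_law [RHS](bigD1 e)//=.
have -> : resampled_field (e :: es) x e = p e x by rewrite /resampled_field mem_head.
rewrite [X in _ = _ * X](eq_bigr (fun e' => bern (resampled_field es x e') (e' \in g))); last first.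
  by move=> e' /negPf e'e; rewrite /resampled_field inE e'e.
(* The step produces the mean at [g] while the field uses the mean at [x]: these agree when the pins
   agree, and otherwise a pinned coordinate makes both sides vanish. *)
have [/eqP xg|xg] := boolP (pin S x == pin S g); first by rewrite (p_pin _ xg).
rewrite (prod_pin_eq0 (x := x) _ _ xg) ?mulr0// => e' e'S.
  by apply: contraNneq ee => <-.
rewrite /resampled_field; case: ifP => // /eS'; by rewrite e'S.
Qed.

End Resampling.

(** * The mixture obtained by resampling the unpinned coordinates *)

Section PinnedMixture.
Variables (R : realType) (E : finType) (nu : {set E} -> R).
Hypothesis nu_gt0 : forall g, 0 < nu g.
Hypothesis nu1 : \sum_g nu g = 1.
Variable S : {set E}.

Let nu_ge0 g : 0 <= nu g. Proof. exact: ltW. Qed.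

Let p := pmean nu S.

Lemma pmean_pin e (g g' : {set E}) : pin S g = pin S g' -> p e g = p e g'.
Proof. exact: cexp_congr. Qed.

Let p01 e (g : {set E}) : e \notin S -> 0 < p e g < 1.
Proof. exact: pmean_in01. Qed.

(** On a pair differing at [e], resampling changes both values by the mass of the pair times the
    same deviation, hence the factor 2. *)
Lemma l1_resample_pmean e : e \notin S ->
  \sum_g `|nu g - resample p e nu g| = 2 * \sum_g nu g * `|glauber nu e g - p e g|.
Proof.
move=> eS; rewrite big_distrr/= (sum_set_pairs e) [RHS](sum_set_pairs e).
apply: eq_bigr => g eg; rewrite /resample /glauber setU1U1 setU1D1 setD1U1 setD1D1.
rewrite !(pU pmean_pin)// !(pD pmean_pin)// /bern !inE eqxx/=.
have := nu_gt0 (e |: g); have := nu_gt0 (g :\ e).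
move: (nu (g :\ e)) (nu (e |: g)) (p e g) => y x r y0 x0.
have s0 : 0 < x + y by rewrite addr_gt0.
have -> : x - (x + y) * r = (x + y) * (x / (x + y) - r) by field; rewrite gt_eqF.
have -> : y - (x + y) * (1 - r) = - ((x + y) * (x / (x + y) - r)) by field; rewrite gt_eqF.
rewrite normrN normrM (gtr0_norm s0); ring.
Qed.

Definition free_coords : seq E := enum (~: S).

Lemma free_coordsP : {in free_coords, forall e, e \notin S}.
Proof. by move=> e; rewrite mem_enum inE. Qed.

Definition pinned_law : {set E} -> R := resamples p free_coords nu.

Definition pinned_field (x : {set E}) : E -> R := resampled_field p free_coords x.

Lemma pinned_fieldE x e : pinned_field x e = if e \in S then (e \in x)%:R else p e x.
Proof. by rewrite /pinned_field /resampled_field mem_enum inE; case: (e \in S). Qed.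

Lemma pinned_field_in01 x e : 0 <= pinned_field x e <= 1.
Proof.
rewrite pinned_fieldE; case: ifP => [_|/negbT /(p01 x)].
  by rewrite ler0n lern1 leq_b1.
by move=> /andP[/ltW -> /ltW ->].
Qed.

Lemma pinned_law_mixture g :
  pinned_law g = \sum_x nu x * product_law (pinned_field x) g.
Proof.
exact: (resamples_mixture pmean_pin nu (enum_uniq _) free_coordsP).
Qed.

(** Only those [x] with the pins of [g] contribute to the mixture: the pins keep their law, and
    given them the free coordinates are independent. *)
Lemma pinned_lawE g :
  pinned_law g = mass nu (pin S) g * \prod_(e | e \notin S) bern (p e g) (e \in g).
Proof.
rewrite pinned_law_mixture /mass big_distrl [RHS]big_mkcond/=; apply: eq_bigr => x _.
case: ifP => [/eqP xg|/negbT xg]; last first.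
  rewrite /product_law (prod_pin_eq0 (S := S) (x := x)) ?mulr0// => e eS.
  by rewrite pinned_fieldE eS.
congr (_ * _); rewrite /product_law (bigID (mem S))/= big1 ?mul1r => [|e eS].
  by apply: eq_bigr => e /negPf eS; rewrite pinned_fieldE eS (pmean_pin _ xg).
rewrite pinned_fieldE eS bern_indicator; have := eq_in_set xg e.
by rewrite !inE eS !andbT => ->; rewrite eqxx.
Qed.

Lemma pinned_law_ge0 g : 0 <= pinned_law g.
Proof.
rewrite pinned_lawE; apply: mulr_ge0; first by apply: ltW; exact: mass_gt0.
apply: prodr_ge0 => e /(p01 g)/andP[h0 h1].
by rewrite /bern; case: ifP; lra.
Qed.

Lemma coupled_pinned_law :
  coupled nu pinned_law
    (2 * \sum_(e | e \notin S) \sum_g nu g * `|glauber nu e g - pmean nu S e g|).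
Proof.
apply: coupled_le (coupled_resamples pmean_pin p01 free_coordsP nu_ge0).
rewrite big_enum_cond big_distrr/= [leRHS](eq_bigl (mem (~: S))); last first.
  by move=> e; rewrite !inE.
rewrite le_eqVlt; apply/orP; left; apply/eqP; apply: eq_big => [e|e].
  by rewrite /= andbT.
rewrite !inE ?andbT => eS; exact: l1_resample_pmean.
Qed.

Definition entropy (q : {set E} -> R) : R := - \sum_g q g * ln (q g).

Definition product_entropy (a : E -> R) : R :=
  - \sum_e (a e * ln (a e) + (1 - a e) * ln (1 - a e)).

(** Take logarithms in [pinned_lawE]: the free coordinates give the mean product entropy, and the
    pins add at most the logarithm of their number of values. *)
Lemma entropy_pinned_law_le :
  entropy pinned_law <= \sum_x nu x * product_entropy (pinned_field x) + #|S|%:R * ln 2.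
Proof.
have bern_gt0 e g b : e \notin S -> 0 < bern (p e g) b.
  by move=> /(p01 g)/andP[h0 h1]; rewrite /bern; case: b; lra.
have mS : forall g e, e \in free_coords -> mass nu (pin S) (e |: g) = mass nu (pin S) g.
  by move=> g e /free_coordsP eS; apply: mass_congr; exact: pin_setU1_out.
have mD : forall g e, e \in free_coords -> mass nu (pin S) (g :\ e) = mass nu (pin S) g.
  by move=> g e /free_coordsP eS; apply: mass_congr; exact: pin_setD1_out.
have lnq g : pinned_law g * ln (pinned_law g) =
    pinned_law g * ln (mass nu (pin S) g) +
    \sum_(e | e \notin S) pinned_law g * ln (bern (p e g) (e \in g)).
  rewrite -big_distrr/= -mulrDr; congr (_ * _); rewrite pinned_lawE.
  rewrite lnM ?posrE ?mass_gt0 ?prodr_gt0//; last by move=> e; exact: bern_gt0.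
  congr (_ + _).
  have [] : 0 < \prod_(e | e \notin S) bern (p e g) (e \in g) /\
         ln (\prod_(e | e \notin S) bern (p e g) (e \in g)) =
         \sum_(e | e \notin S) ln (bern (p e g) (e \in g)); last by [].
  apply: (big_ind2 (fun x y => 0 < x /\ ln x = y)); first by rewrite ln1.
    by move=> x y x' y' [x0 <-] [x'0 <-]; rewrite mulr_gt0// lnM.
  by move=> e eS; rewrite bern_gt0.
rewrite /entropy (eq_bigr _ (fun g _ => lnq g)) big_split/= exchange_big/=.
have -> : \sum_g pinned_law g * ln (mass nu (pin S) g) =
          \sum_g nu g * ln (mass nu (pin S) g).
  apply: (sum_resamples_inv pmean_pin _ free_coordsP) => e ee g; by rewrite ?mS ?mD.
have -> : \sum_(e | e \notin S) \sum_g pinned_law g * ln (bern (p e g) (e \in g)) =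
    - \sum_x nu x * product_entropy (pinned_field x).
  rewrite /product_entropy.
  rewrite -sumrN; under [RHS]eq_bigr do rewrite mulrN opprK big_distrr/=.
  rewrite [RHS]exchange_big/= [RHS](bigID (mem S))/= [X in _ = X + _]big1 ?add0r; last first.
    (* At a pinned coordinate the field is 0 or 1, so its entropy is 0. *)
    move=> e eS; apply: big1 => x _; rewrite pinned_fieldE eS.
    by case: (e \in x); rewrite /= ?subrr ?subr0 ln1 ?mul0r ?mulr0 ?addr0 ?mulr0.
  apply: eq_bigr => e eS.
  have ef : e \in free_coords by rewrite mem_enum inE.
  rewrite /pinned_law (resamples_rem pmean_pin _ free_coordsP ef).
  have sub e' : e' \in rem e free_coords -> e' \notin S /\ e' != e.
    rewrite mem_rem_uniq ?enum_uniq// inE => /andP[ne /free_coordsP]; by split.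
  rewrite (sum_resamples_inv pmean_pin); last 3 first.
  - by move=> e' /sub[].
  - move=> e' /sub[e'S ne] g; rewrite (pU pmean_pin)// !inE eq_sym (negPf ne)//.
  - move=> e' /sub[e'S ne] g; rewrite (pD pmean_pin)// !inE eq_sym ne//.
  rewrite (sum_resample pmean_pin)//; apply: eq_bigr => x _.
  rewrite (pU pmean_pin)// (pD pmean_pin)// !inE eqxx/= pinned_fieldE (negPf eS).
  by rewrite /bern.
rewrite opprD opprK addrC lerD2l.
have := sum_ln_mass_ge nu_gt0 nu1 (k := pin S) (D := powerset S).
rewrite card_powerset natrX lnXn ?ltr0n// -[ln 2 *+ _]mulr_natl => H.
by rewrite lerNl; apply: H => g; rewrite inE /pin finset.subsetIr.
Qed.

End PinnedMixture.

(** * Finitely supported mixing measures *)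

Section FiniteProbability.
Variables (R : realType) (w : nat -> {nonneg R}) (n : nat).

(** The anonymous argument carries the normalization, so that the probability instance can be
    attached to the measure itself. *)
Definition weighted_dirac & (\sum_(k < n) (w k)%:num = 1 :> R) : set nat -> \bar R :=
  msum (fun k => mscale (w k) \d_k) n.

Hypothesis w1 : \sum_(k < n) (w k)%:num = 1 :> R.

HB.instance Definition _ := Measure.on (weighted_dirac w1).

Lemma weighted_dirac_setT : weighted_dirac w1 setT = 1%E.
Proof.
rewrite /weighted_dirac /msum /= -[RHS]/(1%:E) -w1 -sumEFin; apply: eq_bigr => k _.
by rewrite /mscale/= diracT mule1.
Qed.

HB.instance Definition _ :=
  @Measure_isProbability.Build _ _ R (weighted_dirac w1) weighted_dirac_setT.

Lemma integral_weighted_dirac (f : nat -> \bar R) : (forall x, 0 <= f x)%E ->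
  (\int[weighted_dirac w1]_y f y = \sum_(k < n) (w k)%:num%:E * f k)%E.
Proof.
move=> f0; rewrite /weighted_dirac ge0_integral_measure_sum//=.
apply: eq_bigr => i _.
by rewrite ge0_integral_mscale//= integral_dirac//= diracT mul1e.
Qed.

End FiniteProbability.

Lemma Ient_ge0 (R : realType) (N : nat) (a : edge N -> R) :
  (forall e, 0 <= a e <= 1) -> 0 <= Ient a.
Proof.
move=> a01; rewrite oppr_ge0; apply: sumr_le0 => e _; have /andP[h0 h1] := a01 e.
by rewrite -[leRHS]addr0 lerD// mulr_ge0_le0 ?ln_le0//; lra.
Qed.

(** The mixing measure is transported to [nat] by enumerating the graphs; every function on [nat] is
    measurable and the integrals become finite sums. *)
Lemma eps_mixture_finite (R : realType) (N : nat) (eps : R) (nu : graph N -> R)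
    (a : graph N -> edge N -> R) (q : graph N -> R) :
  (forall x, 0 <= nu x) -> \sum_x nu x = 1 -> (forall x e, 0 <= a x e <= 1) ->
  (forall g, q g = \sum_x nu x * indep_prob (a x) g) ->
  graph_entropy q <= \sum_x nu x * Ient (a x) + eps * 'C(N, 2)%:R ->
  eps_mixture eps q.
Proof.
move=> nu0 nu1 a01 qE qent.
(* The default of [nth] is reached only at indices from [n] on, which carry no mass. *)
pose n := #|{: graph N}|; pose gr (k : nat) : graph N := nth finset.set0 (enum {: graph N}) k.
pose w k : {nonneg R} := NngNum (nu0 (gr k)).
have sumE (F : graph N -> R) : \sum_(k < n) F (gr k) = \sum_x F x.
  rewrite -(big_mkord xpredT (fun k => F (gr k))) /n cardE -(big_nth _ xpredT F) big_enum_cond.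
  by apply: eq_bigl => x; rewrite inE.
have w1 : \sum_(k < n) (w k)%:num = 1 :> R by rewrite -nu1 -sumE.
exists _, nat, (weighted_dirac w1), (fun k => a (gr k)); split; first by move=> k.
split; first by move=> e _ Y _; exact: I.
have intE (F : graph N -> R) : (forall x, 0 <= F x) ->
    (\int[weighted_dirac w1]_k (F (gr k))%:E)%E = (\sum_x nu x * F x)%:E.
  move=> F0; rewrite integral_weighted_dirac; last by move=> k; rewrite lee_fin.
  by rewrite -(sumE (fun x => nu x * F x)) -sumEFin; apply: eq_bigr.
split.
  move=> g; rewrite (intE (fun x => indep_prob (a x) g)) ?qE// => x.
  apply: prodr_ge0 => e _; have /andP[h0 h1] := a01 x e; case: ifP => _ //; lra.
rewrite (intE (fun x => Ient (a x))) -?EFinD ?lee_fin// => x.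
exact: Ient_ge0.
Qed.

Lemma card_edge (N : nat) : #|{: edge N}| = 'C(N, 2).
Proof.
rewrite card_sig -sum1_card -bin2_sum big_mkord.
transitivity (\sum_(j < N) \sum_(i < N | (i < j)%N) 1)%N.
  rewrite (exchange_big_dep xpredT)//= pair_big_dep/=.
  by apply: eq_bigl => -[i j].
apply: eq_bigr => j _; rewrite (big_ord_narrow (ltnW (ltn_ord j))).
by rewrite sum1_card card_ord.
Qed.

Lemma eps_mixture_pinned (R : realType) (N : nat) (eps : R) (nu : graph N -> R)
    (S : {set edge N}) :
  (forall g, 0 < nu g) -> \sum_g nu g = 1 -> #|S|%:R * ln 2 <= eps * 'C(N, 2)%:R ->
  eps_mixture eps (pinned_law nu S).
Proof.
move=> nu0 nu1 Seps.
apply: (@eps_mixture_finite _ _ _ nu (pinned_field nu S)) => //.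
- by move=> g; exact: ltW.
- by move=> x e; exact: pinned_field_in01.
- by move=> g; exact: pinned_law_mixture.
- apply: le_trans (entropy_pinned_law_le nu0 nu1 S) _; by rewrite lerD2l.
Qed.

(** * The log-odds of an edge in terms of cuts *)

Section EdgeEndpoints.
Variable N : nat.
Implicit Types (e : edge N) (g : graph N) (x y : 'I_N).

Definition joins e x y : bool :=
  (((val e).1 == x) && ((val e).2 == y)) || (((val e).1 == y) && ((val e).2 == x)).

Lemma adjE g x y : adj g x y = [exists e in g, joins e x y].
Proof. by []. Qed.

Lemma endpoints_lt e : ((val e).1 < (val e).2)%N.
Proof. exact: (valP e). Qed.

Lemma joins_inj e e' x y : joins e x y -> joins e' x y -> e = e'.
Proof.
have := endpoints_lt e; have := endpoints_lt e'.
case: e e' => [[a b] /= h] [[a' b'] /= h']; rewrite /joins /= => l' l H1 H2.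
apply: val_inj => /=.
by case/orP: H1 => /andP[/eqP ? /eqP ?]; case/orP: H2 => /andP[/eqP ? /eqP ?]; subst => //;
  move: (ltn_trans l l'); rewrite ltnn.
Qed.

Lemma joins_injr e x y y' : joins e x y -> joins e x y' -> y = y'.
Proof.
have := endpoints_lt e.
case: e => [[a b] /= h]; rewrite /joins /= => l H1 H2.
by case/orP: H1 => /andP[/eqP ? /eqP ?]; case/orP: H2 => /andP[/eqP ? /eqP ?]; subst => //;
  move: l; rewrite ltnn.
Qed.

Lemma joinsC e x y : joins e x y = joins e y x.
Proof. by rewrite /joins orbC. Qed.

Lemma adjU1 e g x y : adj (e |: g) x y = adj g x y || joins e x y.
Proof.
rewrite !adjE; apply/exists_inP/orP => [[e']|[/exists_inP[e' e'g j]|j]].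
- by rewrite !inE => /orP[/eqP ->|e'g] j; [right|left; apply/exists_inP; exists e'].
- by exists e' => //; rewrite !inE e'g orbT.
- by exists e => //; rewrite !inE eqxx.
Qed.

Lemma adjD1 e g x y : adj (g :\ e) x y = adj g x y && ~~ joins e x y.
Proof.
rewrite !adjE; apply/exists_inP/andP => [[e']|[/exists_inP[e' e'g j] nj]].
  rewrite !inE => /andP[ne e'g] j; split; first by apply/exists_inP; exists e'.
  by apply: contra ne => /joins_inj/(_ j) ->.
exists e' => //; rewrite !inE e'g andbT; by apply: contraNneq nj => <-.
Qed.

Lemma sum_joins_le (R : realType) e : \sum_x \sum_y (joins e x y)%:R <= 2 :> R.
Proof.
have d (u v : 'I_N) : \sum_x \sum_y ((u == x) && (v == y))%:R = 1 :> R.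
  rewrite (bigD1 u)//= [X in _ + X]big1 ?addr0 => [|x /negPf ux]; last first.
    by apply: big1 => y _; rewrite eq_sym ux.
  rewrite (bigD1 v)//= [X in _ + X]big1 ?addr0 ?eqxx// => y /negPf vy.
  by rewrite [v == y]eq_sym vy andbF.
apply: (@le_trans _ _ (\sum_x \sum_y (((val e).1 == x) && ((val e).2 == y))%:R +
   \sum_x \sum_y (((val e).2 == x) && ((val e).1 == y))%:R)); last by rewrite !d.
rewrite -big_split/=; apply: ler_sum => x _; rewrite -big_split/=; apply: ler_sum => y _.
rewrite /joins [((val e).1 == y) && _]andbC.
by case: (_ && _); case: (_ && _); rewrite /= ?addr0 ?add0r// lerDl.
Qed.

End EdgeEndpoints.

(** * The discrete derivative of homomorphism counts and its approximation by cuts *)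

Section HomDerivative.
Variables (R : realType) (m N : nat) (H : graph m).
Implicit Types (e : edge N) (g : graph N) (a : edge m) (f xi : {ffun 'I_m -> 'I_N}).

Definition src a : 'I_m := (val a).1.
Definition tgt a : 'I_m := (val a).2.

Definition adj_img g f a : bool := adj g (f (src a)) (f (tgt a)).
Definition joins_img e f a : bool := joins e (f (src a)) (f (tgt a)).

(* Charges a homomorphism using [e] to a single edge of [H] mapped onto [e]. *)
Definition charged a e f : bool := [pick a' in H | joins_img e f a'] == Some a.

Definition pivotal a e g f : bool :=
  charged a e f && [forall a' in H, adj_img g f a' || joins_img e f a'].

Lemma charged_joins a e f : charged a e f -> joins_img e f a.
Proof. by rewrite /charged; case: pickP => // a' /andP[_ h] /eqP[<-]. Qed.

Lemma homE g : (Defs.hom H g)%:R = \sum_f ([forall a in H, adj_img g f a])%:R :> R.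
Proof.
rewrite /Defs.hom -sum1_card natr_sum big_mkcond/=; apply: eq_bigr => f _.
rewrite inE -[X in if X then _ else _]/[forall a in H, adj_img g f a].
by case: [forall a in H, adj_img g f a].
Qed.

(** The maps lost when [e] is removed are the homomorphisms into [e |: g] that send some edge of [H]
    onto [e]; [charged] assigns each of them to exactly one such edge. *)
Lemma hom_deriv e g :
  (Defs.hom H (e |: g))%:R - (Defs.hom H (g :\ e))%:R =
  \sum_(a in H) \sum_f (pivotal a e g f)%:R :> R.
Proof.
rewrite !homE -sumrB exchange_big/=; apply: eq_bigr => f _.
have -> : [forall a in H, adj_img (e |: g) f a] =
          [forall a in H, adj_img g f a || joins_img e f a].
  by apply: eq_forallb => a; rewrite /adj_img adjU1.
have -> : [forall a in H, adj_img (g :\ e) f a] =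
          [forall a in H, adj_img g f a && ~~ joins_img e f a].
  by apply: eq_forallb => a; rewrite /adj_img adjD1.
rewrite /pivotal /charged; case: pickP => [a0 /andP[a0H ja0]|none].
  have -> : [forall a in H, adj_img g f a && ~~ joins_img e f a] = false.
    by apply/negP => /forall_inP/(_ _ a0H); rewrite ja0 andbF.
  rewrite subr0 (bigD1 a0)//= eqxx big1 ?addr0// => a /andP[_ ne].
  by rewrite (_ : (Some a0 == Some a) = false)//; apply/eqP => -[] h; rewrite h eqxx in ne.
rewrite big1 ?addr0//; apply/eqP; rewrite subr_eq0; apply/eqP; congr (nat_of_bool _)%:R.
apply: eq_forallb => a; have := none a; case: (a \in H) => //= ->.
by rewrite orbF andbT.
Qed.

Definition place xi (i : 'I_m) (x : 'I_N) : {ffun 'I_m -> 'I_N} :=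
  [ffun k => if k == i then x else xi k].

Definition place2 xi a (x y : 'I_N) : {ffun 'I_m -> 'I_N} :=
  place (place xi (src a) x) (tgt a) y.

Lemma src_neq_tgt a : (src a == tgt a) = false.
Proof. by have := endpoints_lt a; rewrite ltn_neqAle => /andP[/negPf]. Qed.

Lemma place2_src xi a x y : place2 xi a x y (src a) = x.
Proof. by rewrite !ffunE src_neq_tgt eqxx. Qed.

Lemma place2_tgt xi a x y : place2 xi a x y (tgt a) = y.
Proof. by rewrite !ffunE eqxx. Qed.

(** Exchanging the images of the endpoints of [a] with [(x, y)] is an involution on triples
    [(xi, x, y)]. The factor [N ^ 2] it creates is the one in the exponent of the random graph
    law. *)
Lemma sum_place2 a (F : {ffun 'I_m -> 'I_N} -> R) :
  N%:R ^+ 2 * \sum_f F f = \sum_xi \sum_x \sum_y F (place2 xi a x y).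
Proof.
pose swap (t : {ffun 'I_m -> 'I_N} * ('I_N * 'I_N)) :=
  (place2 t.1 a t.2.1 t.2.2, (t.1 (src a), t.1 (tgt a))).
have swapK : involutive swap.
  move=> [xi [x y]]; rewrite /swap /= place2_src place2_tgt; congr (_, _).
  apply/ffunP => k; rewrite !ffunE.
  by rewrite /=; case: (eqVneq k (tgt a)) => [->//|_]; case: (eqVneq k (src a)) => [->|].
under [RHS]eq_bigr do rewrite pair_big/=.
rewrite pair_big/= (reindex_inj (inv_inj swapK))/=.
rewrite (eq_bigr (fun t => F t.1)) => [|t _]; last first.
  by have /(congr1 fst) := swapK t; rewrite /= => ->.
rewrite -(pair_big xpredT xpredT (fun f _ => F f))/= big_distrr/=.
apply: eq_bigr => f _; rewrite sumr_const card_prod card_ord.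
by rewrite -[RHS]mulr_natl natrM expr2.
Qed.

Definition incident (i : 'I_m) a : bool := (src a == i) || (tgt a == i).

(* [xi] places the vertices of [H] except the endpoints of [a]; the condition that the other
   edges of [H] be mapped into [g] then splits into a condition on the image of [src a] and
   one on the image of [tgt a], since [a] is the only edge incident to both. *)
Definition ok_at xi a (i j : 'I_m) g (x : 'I_N) : bool :=
  [forall a' in H, (a' != a) && ~~ incident j a' ==> adj_img g (place xi i x) a'].

Definition ok_src xi a g x := ok_at xi a (src a) (tgt a) g x.
Definition ok_tgt xi a g y := ok_at xi a (tgt a) (src a) g y.

Lemma img_place2_src xi a a' x y : ~~ incident (tgt a) a' ->
  (forall g, adj_img g (place2 xi a x y) a' = adj_img g (place xi (src a) x) a') /\
  (forall e, joins_img e (place2 xi a x y) a' = joins_img e (place xi (src a) x) a').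
Proof.
rewrite /incident negb_or => /andP[/negPf h1 /negPf h2].
by split => z; rewrite /adj_img /joins_img !ffunE h1 h2.
Qed.

Lemma img_place2_tgt xi a a' x y : ~~ incident (src a) a' ->
  (forall g, adj_img g (place2 xi a x y) a' = adj_img g (place xi (tgt a) y) a') /\
  (forall e, joins_img e (place2 xi a x y) a' = joins_img e (place xi (tgt a) y) a').
Proof.
rewrite /incident negb_or => /andP[/negPf h1 /negPf h2].
by split => z; rewrite /adj_img /joins_img !ffunE h1 h2.
Qed.

Lemma incident_both a a' : incident (src a) a' -> incident (tgt a) a' -> a' = a.
Proof.
move=> i1 i2; apply: (@joins_inj _ a' a (src a) (tgt a)); last first.
  by rewrite /joins !eqxx.
rewrite /joins -/(src a') -/(tgt a').
have st := src_neq_tgt a.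
case/orP: i1 => /eqP e1; case/orP: i2 => /eqP e2.
- by move: st; rewrite -e1 -e2 eqxx.
- by rewrite e1 e2 !eqxx.
- by rewrite e1 e2 !eqxx orbT.
- by move: st; rewrite -e1 -e2 eqxx.
Qed.

(** An edge other than [a] avoids one endpoint of [a], so it is tested by one of the two
    conditions. *)
Lemma ok_pivotal xi a e g x y :
  charged a e (place2 xi a x y) -> ok_src xi a g x -> ok_tgt xi a g y ->
  pivotal a e g (place2 xi a x y).
Proof.
move=> ch oks okt; rewrite /pivotal ch /=; apply/forall_inP => a' a'H.
have [->|ne] := eqVneq a' a; first by rewrite charged_joins ?orbT.
have [i1|i1] := boolP (incident (tgt a) a'); last first.
  rewrite (img_place2_src _ _ _ i1).1.
  by have /forall_inP/(_ _ a'H) := oks; rewrite ne i1 /= => ->.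
have i2 : ~~ incident (src a) a'.
  by apply: contra ne => i2; rewrite (incident_both i2 i1).
rewrite (img_place2_tgt _ _ _ i2).1.
by have /forall_inP/(_ _ a'H) := okt; rewrite ne i2 /= => ->.
Qed.

Lemma pivotal_joins xi a e g x y : pivotal a e g (place2 xi a x y) -> joins e x y.
Proof.
move=> /andP[/charged_joins h _]; by rewrite /joins_img place2_src place2_tgt in h.
Qed.

Lemma sum_unique_le1 (I : finType) (P : pred I) :
  (forall i j, P i -> P j -> i = j) -> \sum_i (P i)%:R <= 1 :> R.
Proof.
move=> uP; rewrite -natr_sum lern1 -big_mkcond/= sum1_card.
by apply/fintype.card_le1_eqP => i j Pi Pj; apply: uP.
Qed.

(* A missing edge of [H] placed independently of [y] must be mapped onto [e], which
   then determines [e], and [y] given [x]. *)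
Lemma sum_pivotal_not_ok_src xi a g :
  \sum_x \sum_y \sum_e (pivotal a e g (place2 xi a x y) && ~~ ok_src xi a g x)%:R <= N%:R :> R.
Proof.
rewrite -[X in _ <= X%:R]card_ord -sumr_const; apply: ler_sum => x _; rewrite pair_big/=.
apply: (sum_unique_le1 (P := fun t => pivotal a t.2 g (place2 xi a x t.1) && ~~ ok_src xi a g x)).
move=> [y e] [y' e'] /= /andP[p1 nok] /andP[p2 _].
move: nok; rewrite negb_forall_in => /exists_inP[a' a'H].
rewrite negb_imply => /andP[/andP[ne i1] nadj].
have jj e0 y0 : pivotal a e0 g (place2 xi a x y0) -> joins_img e0 (place xi (src a) x) a'.
  move=> /andP[_ /forall_inP/(_ _ a'H)].
  by rewrite (img_place2_src _ _ _ i1).1 (img_place2_src _ _ _ i1).2 (negPf nadj).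
have ee := joins_inj (jj _ _ p1) (jj _ _ p2); move: p1 p2; rewrite ee.
by move=> /pivotal_joins j1 /pivotal_joins j2; rewrite (joins_injr j1 j2).
Qed.

Lemma sum_pivotal_not_ok_tgt xi a g :
  \sum_x \sum_y \sum_e (pivotal a e g (place2 xi a x y) && ~~ ok_tgt xi a g y)%:R <= N%:R :> R.
Proof.
rewrite -[X in _ <= X%:R]card_ord -sumr_const exchange_big.
apply: ler_sum => y _; rewrite pair_big/=.
apply: (sum_unique_le1 (P := fun t => pivotal a t.2 g (place2 xi a t.1 y) && ~~ ok_tgt xi a g y)).
move=> [x e] [x' e'] /= /andP[p1 nok] /andP[p2 _].
move: nok; rewrite negb_forall_in => /exists_inP[a' a'H].
rewrite negb_imply => /andP[/andP[ne i1] nadj].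
have jj e0 x0 : pivotal a e0 g (place2 xi a x0 y) -> joins_img e0 (place xi (tgt a) y) a'.
  move=> /andP[_ /forall_inP/(_ _ a'H)].
  by rewrite (img_place2_tgt _ _ _ i1).1 (img_place2_tgt _ _ _ i1).2 (negPf nadj).
have ee := joins_inj (jj _ _ p1) (jj _ _ p2); move: p1 p2; rewrite ee.
move=> /pivotal_joins j1 /pivotal_joins j2; rewrite joinsC in j1; rewrite joinsC in j2.
by rewrite (joins_injr j1 j2).
Qed.

(** Being charged does not involve the graph, so the graph enters only through the pair [v] of
    vertex sets, which has [4 ^ N] possible values. *)
Definition cut_term xi a e (v : {set 'I_N} * {set 'I_N}) : R :=
  \sum_x \sum_y [&& charged a e (place2 xi a x y), x \in v.1 & y \in v.2]%:R.

Definition cut_pair xi a g : {set 'I_N} * {set 'I_N} :=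
  ([set x | ok_src xi a g x], [set y | ok_tgt xi a g y]).

Lemma cut_term_ge0 xi a e v : 0 <= cut_term xi a e v.
Proof. by apply: sumr_ge0 => x _; apply: sumr_ge0 => y _; rewrite ler0n. Qed.

Lemma cut_term_le2 xi a e v : cut_term xi a e v <= 2.
Proof.
apply: le_trans (sum_joins_le R e); apply: ler_sum => x _; apply: ler_sum => y _.
rewrite ler_nat; case: (boolP (charged _ _ _)) => //= /charged_joins.
by rewrite /joins_img place2_src place2_tgt => ->; rewrite leq_b1.
Qed.

(** The two counts differ only at pivotal placements where one of the conditions fails, and each
    kind of failure occurs at most [N] times in total. *)
Lemma cut_approx xi a g :
  \sum_e `|\sum_x \sum_y (pivotal a e g (place2 xi a x y))%:R - cut_term xi a e (cut_pair xi a g)|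
  <= 2 * N%:R :> R.
Proof.
apply: (@le_trans _ _ (\sum_e \sum_x \sum_y
   ((pivotal a e g (place2 xi a x y) && ~~ ok_src xi a g x)%:R +
    (pivotal a e g (place2 xi a x y) && ~~ ok_tgt xi a g y)%:R))).
  apply: ler_sum => e _; rewrite /cut_term -sumrB.
  apply: le_trans (ler_norm_sum _ _ _) _; apply: ler_sum => x _.
  rewrite -sumrB; apply: le_trans (ler_norm_sum _ _ _) _; apply: ler_sum => y _.
  rewrite !inE; have := @ok_pivotal xi a e g x y.
  have : pivotal a e g (place2 xi a x y) -> charged a e (place2 xi a x y) by case/andP.
  case: (pivotal _ _ _ _); case: (charged _ _ _); case: (ok_src _ _ _ _); case: (ok_tgt _ _ _ _) => /=;
   rewrite ?(subrr, subr0, sub0r, normr0, normr1, addr0, add0r, normrN)//;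
   move=> h1 h2; try (by have := h1 isT); try (by have := h2 isT isT isT).
  by rewrite lerDl.
have -> : 2 * N%:R = N%:R + N%:R :> R by ring.
apply: le_trans (lerD (sum_pivotal_not_ok_src xi a g) (sum_pivotal_not_ok_tgt xi a g)).
rewrite exchange_big/= -big_split/=; apply: ler_sum => x _.
rewrite exchange_big/= -big_split/=; apply: ler_sum => y _.
by rewrite -big_split.
Qed.

End HomDerivative.

(** The independent coupling, for the case where the target bound is at least the number of
    coordinates. *)
Lemma coupled_prod (R : realType) (E : finType) (q1 q2 : {set E} -> R) :
  (forall g, 0 <= q1 g) -> (forall g, 0 <= q2 g) ->
  \sum_g q1 g = 1 -> \sum_g q2 g = 1 -> coupled q1 q2 #|E|%:R.
Proof.
move=> q10 q20 s1 s2; exists (fun gg => q1 gg.1 * q2 gg.2); split => /=.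
- by move=> gg; rewrite mulr_ge0.
- by move=> g; rewrite -big_distrr/= s2 mulr1.
- by move=> g; rewrite -big_distrl/= s1 mul1r.
apply: (@le_trans _ _ (\sum_gg q1 gg.1 * q2 gg.2 * #|E|%:R)).
  by apply: ler_sum => gg _; rewrite ler_wpM2l ?mulr_ge0// ler_nat max_card.
rewrite -big_distrl/= -(pair_big xpredT xpredT (fun g g' => q1 g * q2 g'))/=.
by under eq_bigr do rewrite -big_distrr/= s2 mulr1; rewrite s1 mul1r.
Qed.

Lemma ln2_in01 (R : realType) : 0 <= ln (2 : R) <= 1.
Proof.
apply/andP; split; first by apply: ln_ge0; lra.
have := @ln_le_sub1 R 2; lra.
Qed.

(** Amounts to [N <= 2 (N - 1)]; it gives [N] the order of the square root of the number of
    edges. *)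
Lemma sqr_le_4bin2 (N : nat) : (1 < N)%N -> (N ^ 2 <= 4 * 'C(N, 2))%N.
Proof.
case: N => [//|[//|N]] _; have := mul_bin_diag N.+2 1; rewrite /= bin1; move: ('C(_, _)) => c h.
move: h; rewrite -mulnn; nia.
Qed.

(** * Exponential random graphs *)

Section ErgmLaw.
Variables (R : realType) (N l : nat) (m : 'I_l -> nat).
Variables (H : forall i : 'I_l, graph (m i)) (beta : 'I_l -> R).
Implicit Types (g : graph N) (e : edge N).

Definition ergm_law g : R :=
  ergm_weight H beta g / \sum_(h : graph N) ergm_weight H beta h.

Lemma ergm_partition_gt0 : 0 < \sum_(h : graph N) ergm_weight H beta h.
Proof.
rewrite (bigD1 finset.set0)//= ltr_pwDl ?expR_gt0// sumr_ge0// => h _.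
by rewrite ltW ?expR_gt0.
Qed.

Lemma ergm_law_gt0 g : 0 < ergm_law g.
Proof. by rewrite divr_gt0 ?expR_gt0// ergm_partition_gt0. Qed.

Lemma ergm_law_sum1 : \sum_g ergm_law g = 1.
Proof. by rewrite -big_distrl/= divff// gt_eqF// ergm_partition_gt0. Qed.

(** Here [a] runs over all potential edges and those outside [H i] get weight 0; the sign of
    [beta i] goes into the cut term, so that weights are nonnegative. *)
Definition cut_index := {i : 'I_l & (edge (m i) * {ffun 'I_(m i) -> 'I_N})%type}.

Definition cut_weight (j : cut_index) : R :=
  `|beta (tag j)| * ((tagged j).1 \in H (tag j))%:R / N%:R ^+ m (tag j).

Definition cut_sets (j : cut_index) g := cut_pair (H (tag j)) (tagged j).2 (tagged j).1 g.

Definition signed_cut_term (j : cut_index) e v : R :=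
  Num.sg (beta (tag j)) * cut_term R (H (tag j)) (tagged j).2 (tagged j).1 e v.

Definition edge_energy : R := \sum_(i < l) `|beta i| * #|H i|%:R.

Lemma edge_energy_ge0 : 0 <= edge_energy.
Proof. by apply: sumr_ge0 => i _; rewrite mulr_ge0. Qed.

Lemma cut_weight_ge0 j : 0 <= cut_weight j.
Proof. by rewrite divr_ge0 ?mulr_ge0 ?exprn_ge0. Qed.

Lemma sum_cut_index (F : forall i : 'I_l, edge (m i) -> {ffun 'I_(m i) -> 'I_N} -> R) :
  \sum_(j : cut_index) F (tag j) (tagged j).1 (tagged j).2 =
  \sum_i \sum_a \sum_xi F i a xi.
Proof.
rewrite -(sig_big_dep (I := 'I_l) (J := fun i => (edge (m i) * {ffun 'I_(m i) -> 'I_N})%type)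
   xpredT (fun _ => xpredT) (fun i t => F i t.1 t.2))/=.
by apply: eq_bigr => i _; rewrite pair_big.
Qed.

Lemma sum_cut_weight : (0 < N)%N -> \sum_j cut_weight j = edge_energy.
Proof.
move=> N0; rewrite (sum_cut_index (fun i a xi => `|beta i| * (a \in H i)%:R / N%:R ^+ m i)).
apply: eq_bigr => i _; rewrite -sum1_card natr_sum [in RHS]big_mkcond big_distrr/=.
apply: eq_bigr => a _; rewrite sumr_const card_ffun !card_ord -[LHS]mulr_natr natrX.
rewrite divfK; last by rewrite expf_neq0// pnatr_eq0 -lt0n.
by case: (a \in H i).
Qed.

Lemma logodds_ergm e g : logodds ergm_law e g =
  N%:R ^+ 2 * \sum_i beta i * (hom_density R (H i) (e |: g) - hom_density R (H i) (g :\ e)).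
Proof.
have Z0 := ergm_partition_gt0.
rewrite /logodds /ergm_law !ln_div ?posrE ?expR_gt0// /ergm_weight !expRK.
have -> : \sum_i beta i * (hom_density R (H i) (e |: g) - hom_density R (H i) (g :\ e)) =
  \sum_i beta i * hom_density R (H i) (e |: g) - \sum_i beta i * hom_density R (H i) (g :\ e).
  by rewrite -sumrB; apply: eq_bigr => i _; rewrite mulrBr.
ring.
Qed.

(** By [hom_deriv] and [sum_place2] the log-odds is exactly the weighted sum of pivotal counts;
    [cut_approx] then costs [2 N] per unit of weight. *)
Lemma logodds_ergm_approx g :
  (0 < N)%N ->
  \sum_e `|logodds ergm_law e g - \sum_j cut_weight j * signed_cut_term j e (cut_sets j g)|
  <= edge_energy * (2 * N%:R).
Proof.
move=> N0; pose D i (a : edge (m i)) xi e : R :=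
  \sum_x \sum_y (pivotal (H i) a e g (place2 xi a x y))%:R.
pose c i (a : edge (m i)) : R := `|beta i| * (a \in H i)%:R / N%:R ^+ m i.
have lE e : logodds ergm_law e g =
    \sum_(j : cut_index) cut_weight j * (Num.sg (beta (tag j)) * D _ (tagged j).1 (tagged j).2 e).
  rewrite (sum_cut_index (fun i a xi => c i a * (Num.sg (beta i) * D i a xi e))).
  rewrite logodds_ergm big_distrr/=; apply: eq_bigr => i _.
  rewrite /hom_density -mulrBl hom_deriv.
  rewrite [in RHS](bigID (fun a => a \in H i))/= [X in _ = _ + X]big1 ?addr0; last first.
    by move=> a /negPf aH; apply: big1 => xi _; rewrite /c aH mulr0 !mul0r.
  transitivity (\sum_(a in H i) beta i / N%:R ^+ m i *
      (N%:R ^+ 2 * \sum_f (pivotal (H i) a e g f)%:R)).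
    rewrite -big_distrr -big_distrr/=; ring.
  apply: eq_bigr => a aH; rewrite (sum_place2 a) -big_distrr -big_distrr/= /c aH mulr1 /D.
  rewrite {1}[beta i]numEsg; ring.
apply: (@le_trans _ _ (\sum_e \sum_(j : cut_index) cut_weight j *
   `|D _ (tagged j).1 (tagged j).2 e - cut_term R (H (tag j)) (tagged j).2 (tagged j).1 e (cut_sets j g)|)).
  apply: ler_sum => e _; rewrite lE -sumrB; apply: le_trans (ler_norm_sum _ _ _) _.
  apply: ler_sum => j _; rewrite -mulrBr /signed_cut_term -mulrBr.
  rewrite normrM (ger0_norm (cut_weight_ge0 j)) ler_wpM2l ?cut_weight_ge0// normrM ler_piMl//.
  by rewrite normr_sg lern1 leq_b1.
rewrite exchange_big/= -(sum_cut_weight N0) big_distrl/=; apply: ler_sum => j _.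
by rewrite -big_distrr/= ler_wpM2l ?cut_weight_ge0// cut_approx.
Qed.

(** The price [mu] is chosen so that the total information [2 N ln 2] per unit of weight pays for at
    most [eps n ln 2] pins, with [n = 'C(N, 2)]; finally [ln 2 <= 1]. *)
Lemma exists_ergm_pins (eps : R) : (1 < N)%N -> 0 < eps ->
  let mu := 2 * N%:R * edge_energy / (eps * 'C(N, 2)%:R) in
  exists S : {set edge N}, #|S|%:R * ln 2 <= eps * 'C(N, 2)%:R /\
    forall e, e \notin S ->
      \sum_j cut_weight j * klgain ergm_law (fun g => (cut_sets j g, pin S g)) (pin S) (contains e) <= mu.
Proof.
move=> N1 eps0 mu; have N0 : (0 < N)%N by apply: ltnW.
have n0 : 0 < 'C(N, 2)%:R :> R by rewrite ltr0n bin_gt0.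
have en0 : 0 < eps * 'C(N, 2)%:R by rewrite mulr_gt0.
have NR0 : 0 < N%:R :> R by rewrite ltr0n.
have /andP[ln20 ln21] := ln2_in01 R.
have := edge_energy_ge0; rewrite le_eqVlt => /predU1P[B0|B0].
  exists finset.set0; rewrite cards0 mul0r; split; first exact: ltW.
  have w0 j : cut_weight j = 0.
    have := sum_cut_weight N0; rewrite -B0 => /eqP.
    rewrite psumr_eq0 => [/allP/(_ j)|i _]; last exact: cut_weight_ge0.
    by rewrite mem_index_enum => /(_ isT)/eqP.
  by move=> e _; rewrite big1 /mu -?B0 ?mulr0 ?mul0r// => j _; rewrite w0 mul0r.
have mu0 : 0 < mu by rewrite divr_gt0 ?mulr_gt0.
have [S [cS gS]] := exists_pins ergm_law_gt0 ergm_law_sum1 (w := cut_weight)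
  cut_sets cut_weight_ge0 mu0.
exists S; split => //.
have lnV : ln #|{: {set 'I_N} * {set 'I_N}}|%:R = 2 * N%:R * ln 2 :> R.
  rewrite card_prod -cardsT -powersetT card_powerset cardsT card_ord -expnD addnn.
  by rewrite natrX lnXn// -[LHS]mulr_natl -mul2n natrM.
move: cS; rewrite lnV sum_cut_weight// /mu.
have -> : edge_energy * (2 * N%:R * ln 2) =
   2 * N%:R * edge_energy / (eps * 'C(N, 2)%:R) * (eps * 'C(N, 2)%:R * ln 2).
  by field; rewrite !gt_eqF.
rewrite ler_pM2l// => cS; apply: (@le_trans _ _ (eps * 'C(N, 2)%:R * ln 2 * ln 2)).
  by rewrite ler_wpM2r.
by rewrite -mulrA ler_piMr ?(ltW en0)// mulr_ile1.
Qed.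

End ErgmLaw.

(** * Numerical optimization of the parameters *)

Section Numerics.
Variable R : realType.

Lemma powR_cube (x : R) : 0 <= x -> (x `^ (1 / 3)) ^+ 3 = x.
Proof.
move=> x0; rewrite -powR_mulrn ?powR_ge0// -powRrM.
by rewrite (_ : 1 / 3 * 3%:R = 1 :> R) ?powRr1//; field.
Qed.

(* All quantities are expressed through [t = n^(1/4)] and [y = (B / (eps t))^(1/3)]. *)
Lemma deviation_le_target (n t y eps B W Q NR : R) :
  n = t ^+ 4 -> 1 <= t -> 0 <= NR <= 2 * t ^+ 2 -> 0 < eps < 1 -> 0 <= B ->
  0 <= y < 1 / 20 -> y ^+ 3 = B / (eps * t) -> 0 <= W -> W ^+ 2 <= n * Q ->
  2 * Q <= n * (2 * NR * B / (eps * n) / (1 / (eps * t)) + B * (1 / (eps * t))) + B * (2 * NR) ->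
  2 * W <= 20 * n * y.
Proof.
move=> nE t1 /andP[N0 Nt] /andP[e0 e1] B0 /andP[y0 y1] yE W0 WQ Qle.
have t0 : 0 < t by lra.
have t0' := ltW t0; have e0' := ltW e0; have e1' := ltW e1.
have et0 : 0 < eps * t by rewrite mulr_gt0.
have n0 : 0 < n by rewrite nE exprn_gt0.
have n0' := ltW n0.
have BE : B = y ^+ 3 * (eps * t) by rewrite yE divfK// gt_eqF.
have y30 : 0 <= y ^+ 3 by rewrite exprn_ge0.
have h1 : n * (2 * NR * B / (eps * n) / (1 / (eps * t))) <= 4 * n * y ^+ 3.
  have -> : n * (2 * NR * B / (eps * n) / (1 / (eps * t))) = (2 * y ^+ 3 * eps * t ^+ 2) * NR.
    by rewrite BE; field; rewrite !gt_eqF.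
  apply: (@le_trans _ _ (2 * y ^+ 3 * eps * t ^+ 2 * (2 * t ^+ 2))).
    by rewrite ler_wpM2l// ?mulr_ge0 ?exprn_ge0//.
  have -> : 2 * y ^+ 3 * eps * t ^+ 2 * (2 * t ^+ 2) = (4 * n * y ^+ 3) * eps by rewrite nE; ring.
  by rewrite ler_piMr ?mulr_ge0//.
have h2 : n * (B * (1 / (eps * t))) = n * y ^+ 3.
  by rewrite BE; field; rewrite !gt_eqF.
have h3 : B * (2 * NR) <= 4 * n * y ^+ 3.
  apply: (@le_trans _ _ (B * (2 * (2 * t ^+ 2)))); first by rewrite ler_wpM2l//; lra.
  have -> : B * (2 * (2 * t ^+ 2)) = (4 * y ^+ 3 * t ^+ 3) * eps by rewrite BE; ring.
  apply: (@le_trans _ _ (4 * y ^+ 3 * t ^+ 3)).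
    by rewrite ler_piMr ?mulr_ge0 ?exprn_ge0//.
  have -> : 4 * n * y ^+ 3 = 4 * y ^+ 3 * t ^+ 3 * t by rewrite nE; ring.
  by rewrite ler_peMr// ?mulr_ge0 ?exprn_ge0//.
(* The constant is 4 + 1 + 4 from [h1], [h2] and [h3]. With [y <= 1] it yields
   [(2 W) ^ 2 <= 18 (n y) ^ 2], well below [(20 n y) ^ 2]. *)
have hQ : 2 * Q <= 9 * (n * y ^+ 3) by move: Qle; rewrite mulrDr h2; lra.
have hy : y ^+ 3 <= y ^+ 2 by rewrite [y ^+ 3]exprS ler_piMl ?sqr_ge0//; lra.
have hQ2 : 2 * Q <= 9 * (n * y ^+ 2).
  have : n * y ^+ 3 <= n * y ^+ 2 by rewrite ler_wpM2l.
  lra.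
rewrite -ler_sqr ?nnegrE ?mulr_ge0//.
have : n * (2 * Q) <= n * (9 * (n * y ^+ 2)) by rewrite ler_wpM2l.
have -> : n * (9 * (n * y ^+ 2)) = 9 * (n * y) ^+ 2 by ring.
rewrite !exprMn; have := sqr_ge0 (n * y); rewrite exprMn; lra.
Qed.

(** Since [t ^ (1/3) = n ^ (1/12)], dividing [n] by it leaves the exponent 11/12. *)
Lemma target_powE (n eps B : R) : 0 < n -> 0 < eps -> 0 <= B ->
  exists t y : R, [/\ n = t ^+ 4, 0 < t, 0 <= y, y ^+ 3 = B / (eps * t) &
    20 * (n `^ (11 / 12)) / (eps `^ (1 / 3)) * (B `^ (1 / 3)) = 20 * n * y].
Proof.
move=> n0 e0 B0; pose t := n `^ (1 / 4).
have t0 : 0 < t by rewrite powR_gt0.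
have et0 : 0 < eps * t by rewrite mulr_gt0.
have yE : (B / (eps * t)) `^ (1 / 3) = B `^ (1 / 3) / (eps `^ (1 / 3) * n `^ (1 / 12)).
  have yet : (B / (eps * t)) `^ (1 / 3) * (eps * t) `^ (1 / 3) = B `^ (1 / 3).
    by rewrite -powRM ?divr_ge0 ?(ltW et0)// divfK// gt_eqF.
  have -> : n `^ (1 / 12) = t `^ (1 / 3) by rewrite /t -powRrM; congr (_ `^ _); field.
  by rewrite -powRM ?ltW// -yet mulfK// gt_eqF// powR_gt0.
exists t, ((B / (eps * t)) `^ (1 / 3)); split=> //.
- rewrite -powR_mulrn ?powR_ge0// -powRrM.
  by rewrite (_ : 1 / 4 * 4%:R = 1 :> R) ?powRr1 ?ltW//; field.
- by rewrite powR_ge0.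
- by rewrite powR_cube// divr_ge0// ltW.
rewrite yE.
have nn : n = n `^ (11 / 12) * n `^ (1 / 12).
  rewrite -powRD; last by rewrite gt_eqF// implybT.
  by rewrite (_ : 11 / 12 + 1 / 12 = 1 :> R) ?powRr1 ?ltW//; field.
rewrite {2}nn; field; by rewrite !gt_eqF ?powR_gt0.
Qed.

End Numerics.

(** * Assembling the coupling and the mixture *)

Theorem theorem1p13 (R : realType) (N l : nat) (m : 'I_l -> nat)
    (H : forall i : 'I_l, graph (m i)) (beta : 'I_l -> R) (eps : R) :
  0 < eps < 1 / 2 ->
  exists mu : graph N * graph N -> R,
    (forall gg, 0 <= mu gg) /\
    \sum_(gg : graph N * graph N) mu gg = 1 /\
    (forall g : graph N,
        \sum_(g' : graph N) mu (g, g')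
        = ergm_weight H beta g / \sum_(h : graph N) ergm_weight H beta h) /\
    eps_mixture eps (fun g' : graph N => \sum_(g : graph N) mu (g, g')) /\
    \sum_(gg : graph N * graph N) mu gg * (dH gg.1 gg.2)%:R
      <= 20 * ('C(N, 2)%:R `^ (11 / 12)) / (eps `^ (1 / 3))
         * ((\sum_(i < l) `|beta i| * #|H i|%:R) `^ (1 / 3)).
Proof.
move=> /andP[eps0 eps_lt]; set C := 20 * _ / _ * _.
have nu0 : forall g : graph N, 0 < ergm_law H beta g by exact: ergm_law_gt0.
have nu1 : \sum_(g : graph N) ergm_law H beta g = 1 by exact: ergm_law_sum1.
suff [S Seps cS] : exists2 S : {set edge N}, #|S|%:R * ln 2 <= eps * 'C(N, 2)%:R &
    coupled (ergm_law H beta) (pinned_law (ergm_law H beta) S) C.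
  have [mu [mu0 mu1 mu2 muC]] := cS; exists mu; split => //; split; [|split => //; split => //].
    rewrite -nu1 -(eq_bigr _ (fun g _ => mu1 g)) pair_big/=.
    by apply: eq_bigr => -[].
  have -> : (fun g' => \sum_g mu (g, g')) = pinned_law (ergm_law H beta) S by apply/funext.
  exact: eps_mixture_pinned.
have C0 : 0 <= C by rewrite mulr_ge0 ?divr_ge0 ?mulr_ge0 ?powR_ge0.
(* If the target is at least the number of edges, independent coupling without pins suffices.
   Otherwise there is an edge, so [N >= 2], and the target being below [n] means [y < 1 / 20]. *)
have [nC|Cn] := leP ('C(N, 2)%:R : R) C.
  exists finset.set0; first by rewrite cards0 mul0r mulr_ge0// ltW.
  apply: coupled_le nC _; rewrite -card_edge; apply: coupled_prod => //.
  - by move=> g; exact: ltW.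
  - exact: pinned_law_ge0.
  - under eq_bigr do rewrite -[pinned_law _ _ _]mulr1.
    rewrite (sum_resamples_inv (@pmean_pin _ _ _ _) _ (@free_coordsP _ _))//.
    by under eq_bigr do rewrite mulr1.
have n0 : 0 < 'C(N, 2)%:R :> R by apply: le_lt_trans C0 Cn.
have N1 : (1 < N)%N by rewrite -bin_gt0 -(ltr0n R).
have N0 : (0 < N)%N by apply: ltnW.
have [t [y [nE t0 y0 yE CE]]] := target_powE n0 eps0 (edge_energy_ge0 H beta).
have [S [Seps gS]] := exists_ergm_pins H beta N1 eps0.
exists S => //; apply: coupled_le (coupled_pinned_law nu0 S).
rewrite /C CE; apply: (deviation_le_target (eps := eps) (NR := N%:R) nE _ _ _ _ _ yE _ _ _).
- have : 1 <= t ^+ 4 by rewrite -nE ler1n -(ltr0n R).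
  by rewrite expr_ge1 ?(ltW t0).
- have tt : N%:R ^+ 2 <= (2 * t ^+ 2) ^+ 2 :> R.
    have -> : (2 * t ^+ 2) ^+ 2 = 4 * 'C(N, 2)%:R :> R by rewrite nE; ring.
    by rewrite -!natrX -natrM ler_nat; exact: sqr_le_4bin2.
  by move: tt; rewrite ler_sqr ?nnegrE ?ler0n ?mulr_ge0 ?exprn_ge0 ?(ltW t0)//= => ->; rewrite ler0n.
- rewrite eps0; lra.
- exact: edge_energy_ge0.
- rewrite y0; move: Cn; rewrite /C CE; have -> : 20 * 'C(N, 2)%:R * y = 'C(N, 2)%:R * (20 * y) by ring.
  rewrite gtr_pMr//; lra.
- by apply: sumr_ge0 => e _; apply: sumr_ge0 => g _; rewrite mulr_ge0// ltW.
- by rewrite -card_edge; exact: sum_glauber_dev_le.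
(* Here [c = 1 / (eps * t)], which makes both [mu / c] and the energy times [c] at most a constant
   times [y ^ 3]. *)
rewrite -[in X in _ <= X * _ + _]card_edge -(sum_cut_weight H beta N0).
apply: (sum_glauber_var_le nu0 nu1 (V := cut_sets H) (M := @signed_cut_term R N l m H beta)) => //.
- exact: cut_weight_ge0.
- by rewrite divr_gt0// mulr_gt0.
- by rewrite divr_ge0 ?mulr_ge0 ?sumr_ge0 ?(ltW eps0)// => j _; exact: cut_weight_ge0.
- by rewrite (sum_cut_weight H beta N0).
- move=> j e v; rewrite normrM normr_sg ger0_norm ?cut_term_ge0//.
  apply: (le_trans _ (cut_term_le2 R (H (tag j)) (tagged j).2 (tagged j).1 e v)); rewrite ler_piMl ?cut_term_ge0//.
  by rewrite lern1 leq_b1.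
- by move=> g; rewrite (sum_cut_weight H beta N0); exact: logodds_ergm_approx.
Qed.
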